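(* Let $\mathbb{K}$ be a field of characteristic different from $2$, let $d \in \mathbb{K}$ be an element that is not a square in $\mathbb{K}$, and let $\mathcal{E}$ be the Edwards curve over $\mathbb{K}$ with affine equation $x^2 + y^2 = 1 + d x^2 y^2$. Put $O = (0,1)$, $O' = (0,-1)$, $H = (1,0)$, $H' = (-1,0)$. Let $k \ge 0$ be an integer, let $P = (a,b)$ be an affine $\mathbb{K}$-rational point of $\mathcal{E}$ (possibly $P = O$), and let $D = P + kO$, a divisor of positive degree $k+1$. Define the following rational functions on $\mathcal{E}$, written in homogeneous coordinates $[Z:X:Y]$ with $x = X/Z$, $y = Y/Z$: $$F_0 = \frac{Z}{Z} = 1,$$ $$F_1 = \begin{cases} \dfrac{Z}{X} & \text{if } P = O',\\[2mm] \dfrac{(X+Z)(Y+Z)}{XY} & \text{if } P = H,\\[2mm] \dfrac{(X-Z)(Y+Z)}{XY} & \text{if } P = H',\\[2mm] \dfrac{(Y+bZ)\,X}{(X-aZ)(Y-Z)} & \text{if } P \notin \{O', H, H'\}, \end{cases}$$ and, for $2 \le i \le k+1$, $$F_i = \begin{cases} \dfrac{Z^h}{(Y-Z)^h} & \text{if } i = 2h,\\[2mm] \dfrac{(Y+Z)Z^h}{X(Y-Z)^h} & \text{if } i = 2h+1. \end{cases}$$ Then $\dim(\mathcal{L}(D)) = k+1$ and $$\mathcal{L}(D) = \begin{cases} \langle F_0, F_1, F_2, \ldots, F_k\rangle & \text{if } P \ne O,\\ \langle F_0, F_2, F_3, \ldots, F_{k+1}\rangle & \text{if } P = O, \end{cases}$$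 where $\langle \cdots \rangle$ denotes the linear span over $\overline{\mathbb{K}}$, and the dimension is taken over $\overline{\mathbb{K}}$. (For $k = 0$ both lists reduce to $F_0$.)
   Context: $\overline{\mathbb{K}}$ denotes an algebraic closure of $\mathbb{K}$, and $\overline{\mathbb{K}}(\mathcal{E})$ the function field of $\mathcal{E}$ over $\overline{\mathbb{K}}$. The projective closure of $\mathcal{E}$ in $\mathbb{P}^2$, with coordinates $[Z:X:Y]$, is $Z^2X^2 + Z^2Y^2 = Z^4 + dX^2Y^2$. It has exactly two points at infinity, $\Omega_1 = [0:1:0]$ and $\Omega_2 = [0:0:1]$, which are its only singular points (ordinary double points); all affine points are smooth. For a divisor $D$ on $\mathcal{E}$ whose support does not contain $\Omega_1, \Omega_2$, the Riemann-Roch space is $$\mathcal{L}(D) = \{ f \in \overline{\mathbb{K}}(\mathcal{E})^\star : \operatorname{div}(f) + D \text{ is effective}\} \cup \{0\}.$$ Here $\operatorname{div}(f)$ is the divisor of zeros minus poles of $f$. Zeros and poles are counted on the smooth projective model of $\mathcal{E}$ over $\overline{\mathbb{K}}$ (an elliptic curve in Weierstrass form birational to $\mathcal{E}$), with each smooth affine point of $\mathcal{E}$ identified with the unique point of the model above it. In particular, $f \in \mathcal{L}(D)$ must be regular at each of the points of the model lying over $\Omega_1$ and $\Omega_2$. *)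

(* Defs.v *)
From HB Require Import structures.
From mathcomp Require Import all_boot all_order all_algebra.

Set Implicit Arguments.
Unset Strict Implicit.
Unset Printing Implicit Defensive.

Import Order.TTheory GRing.Theory Num.Theory.
Local Open Scope ring_scope.

Definition algebraic_closure (K : fieldType) (L : closedFieldType)
    (j : {rmorphism K -> L}) : Prop :=
  forall z : L, algebraicOver j z.

Definition on_edwards (R : pzRingType) (d : R) (p : R * R) : Prop :=
  p.1 ^+ 2 + p.2 ^+ 2 = 1 + d * p.1 ^+ 2 * p.2 ^+ 2.

(* As in polyXY, 'Y is 'X%:P and u.[x, y] substitutes x for 'X and y for 'Y. *)
Definition edwards_poly (R : comNzRingType) (d : R) : {poly {poly R}} :=
  'X ^+ 2 + 'Y ^+ 2 - (1 + d%:P%:P * 'X ^+ 2 * 'Y ^+ 2).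

Definition eval2 (L F : fieldType) (i : {rmorphism L -> F}) (x y : F)
    (u : {poly {poly L}}) : F :=
  (map_poly (map_poly i) u).[x, y].

(* F, with its elements x and y, is the fraction field of L[X, Y] / (E), i.e.
   the function field of the plane curve E = 0; this determines (F, i, x, y)
   up to a unique isomorphism. *)
Record is_function_field (L F : fieldType) (i : {rmorphism L -> F}) (x y : F)
    (E : {poly {poly L}}) : Prop := IsFunctionField {
  ff_relations : forall u : {poly {poly L}},
    eval2 i x y u = 0 <-> exists w : {poly {poly L}}, u = w * E;
  ff_fractions : forall f : F, exists u w : {poly {poly L}},
    eval2 i x y w != 0 /\ f = eval2 i x y u / eval2 i x y w
}.

(* The points of the smooth projective model of a curve over the algebraically
   closed field L are the places of its function field F: the normalized
   discrete valuations of F that are trivial on L. The order of 0, normally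
   +oo, is set to 0, so that a place is determined by its order function. *)
Record place (L F : fieldType) (i : {rmorphism L -> F}) : Type := Place {
  ord :> F -> int;
  ord0 : ord 0 = 0;
  ordC : forall c : L, ord (i c) = 0;
  ordM : forall f g : F, f != 0 -> g != 0 -> ord (f * g) = ord f + ord g;
  ordD : forall f g : F, f != 0 -> g != 0 -> f + g != 0 ->
    Num.min (ord f) (ord g) <= ord (f + g);
  ord_normalized : exists f : F, ord f = 1
}.

(* v lies above the affine point p when both generators of the maximal ideal of
   the local ring at p vanish at v. *)
Definition lies_above (L F : fieldType) (i : {rmorphism L -> F}) (x y : F)
    (p : L * L) (v : place i) : bool :=
  (0 < v (x - i p.1)) && (0 < v (y - i p.2)).

Definition divisor (L F : fieldType) (i : {rmorphism L -> F}) : Type :=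
  place i -> int.

(* A smooth point p has exactly one place above it; this is its divisor. *)
Definition point_divisor (L F : fieldType) (i : {rmorphism L -> F}) (x y : F)
    (p : L * L) : divisor i :=
  fun v => if lies_above x y p v then 1 else 0.

Definition div_of (L F : fieldType) (i : {rmorphism L -> F}) (f : F) :
    divisor i :=
  fun v => v f.

Definition effective (L F : fieldType) (i : {rmorphism L -> F})
    (D : divisor i) : Prop :=
  forall v : place i, 0 <= D v.

Definition riemann_roch_space (L F : fieldType) (i : {rmorphism L -> F})
    (D : divisor i) (f : F) : Prop :=
  (f != 0 /\ effective (fun v => div_of f v + D v)) \/ f = 0.

Definition lin_comb (L F : fieldType) (i : {rmorphism L -> F}) (s : seq F)
    (c : 'I_(size s) -> L) : F :=
  \sum_(m < size s) i (c m) * s`_m.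

Definition lin_span (L F : fieldType) (i : {rmorphism L -> F}) (s : seq F)
    (f : F) : Prop :=
  exists c : 'I_(size s) -> L, f = lin_comb i c.

Definition lin_independent (L F : fieldType) (i : {rmorphism L -> F})
    (s : seq F) : Prop :=
  forall c : 'I_(size s) -> L, lin_comb i c = 0 -> forall m, c m = 0.

Definition has_dimension (L F : fieldType) (i : {rmorphism L -> F})
    (V : F -> Prop) (n : nat) : Prop :=
  exists s : seq F, [/\ size s = n, lin_independent i s
                      & forall f : F, V f <-> lin_span i s f].

(* The functions F_m dehomogenized at Z = 1; h : K -> F embeds the ground
   field. *)
Definition edwards_F1 (K F : fieldType) (h : K -> F) (x y : F)
    (P : K * K) : F :=
  if P == (0, -1) then 1 / x
  else if P == (1, 0) then (x + 1) * (y + 1) / (x * y)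
  else if P == (-1, 0) then (x - 1) * (y + 1) / (x * y)
  else (y + h P.2) * x / ((x - h P.1) * (y - 1)).

Definition edwards_F (K F : fieldType) (h : K -> F) (x y : F)
    (P : K * K) (m : nat) : F :=
  if m == 0%N then 1
  else if m == 1%N then edwards_F1 h x y P
  else if odd m then (y + 1) / (x * (y - 1) ^+ m./2)
  else 1 / (y - 1) ^+ m./2.

(* Main.v *)
Require Import Defs.
From HB Require Import structures.
From mathcomp Require Import all_boot all_order all_algebra.
From mathcomp Require Import zify ring.
From Stdlib Require Import Classical ClassicalEpsilon.

(* Places are only used through their order functions.

   Existence: with z = x (1 - d y^2), the function field is L(y)(z), where
   z^2 = (1 - y^2)(1 - d y^2) is squarefree in y.  The local ring of this curve
   at a point is a discrete valuation ring with uniformizer y - y0, or z at a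
   branch point, which gives a place at every affine point of the Edwards curve
   and at every point with x = oo; exchanging x and y gives those with y = oo.

   L(P) = L: write f = (p(y) + q(y) x) / g(y) in lowest terms.  Evaluating at
   the two places above a root y0 of g, x = x0 and x = -x0, gives
   p(y0) = q(y0) = 0 unless y0 = b, so g divides y - b.  Evaluating at y = oo
   bounds the degrees of p and q by that of g, and evaluating at x = oo makes
   q vanish at both roots of d y^2 = 1, so that q = 0 and f is constant.

   F_m has order -m at O and, except for F_1 at P, no other pole, so subtracting
   multiples of the F_m reduces L(P + k O) to L(P), and independence holds
   because the orders at O are distinct. *)

Set Implicit Arguments.
Unset Strict Implicit.
Unset Printing Implicit Defensive.

Import Order.TTheory GRing.Theory Num.Theory.
Local Open Scope ring_scope.

(** * Orders at a place *)

Section Orders.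

Variables (L F : fieldType) (i : {rmorphism L -> F}).
Implicit Types (v : place i) (f g : F) (m n : int).

(* "The order of f is at least n", with order +oo at f = 0, where [v 0] is
   the junk value 0. *)
Definition vge v n f : bool := (f == 0) || (n <= v f).

Lemma vge0 v n : vge v n 0.
Proof. by rewrite /vge eqxx. Qed.

Lemma vge_ord v n f : n <= v f -> vge v n f.
Proof. by rewrite /vge orbC => ->. Qed.

Lemma ord_vge v n f : f != 0 -> vge v n f -> n <= v f.
Proof. by rewrite /vge => /negbTE->. Qed.

Lemma vgeW v m n f : m <= n -> vge v n f -> vge v m f.
Proof. by rewrite /vge => le_mn; case: eqP => //= _; apply: le_trans. Qed.

Lemma vgeD v n f g : vge v n f -> vge v n g -> vge v n (f + g).
Proof.
rewrite /vge; have [->|f0] /= := eqVneq f 0; first by rewrite add0r.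
have [->|g0] /= := eqVneq g 0; first by rewrite addr0 (negbTE f0).
have [//|fg0 /=] := eqVneq (f + g) 0 => vf vg.
by apply: le_trans (ordD v f0 g0 fg0); rewrite le_min vf.
Qed.

Lemma vgeM v m n f g : vge v m f -> vge v n g -> vge v (m + n) (f * g).
Proof.
rewrite /vge mulf_eq0; have [//|f0] /= := eqVneq f 0.
have [//|g0 /= vf vg] := eqVneq g 0.
by rewrite ordM // lerD.
Qed.

Lemma vgeM0 v n f g : vge v 0 f -> vge v n g -> vge v n (f * g).
Proof. by move=> vf vg; rewrite -[n]add0r vgeM. Qed.

Lemma vge_const v n c : n <= 0 -> vge v n (i c).
Proof. by move=> n0; rewrite vge_ord // ordC. Qed.

Lemma vge1 v : vge v 0 1.
Proof. by rewrite -(rmorph1 i) vge_const. Qed.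

Lemma vgeN v n f : vge v n f -> vge v n (- f).
Proof.
move=> vf; rewrite -mulN1r -(rmorph1 i) -(rmorphN i).
by rewrite vgeM0 ?vge_const.
Qed.

Lemma vgeB v n f g : vge v n f -> vge v n g -> vge v n (f - g).
Proof. by move=> vf vg; rewrite vgeD ?vgeN. Qed.

Lemma vge_sum v n (I : Type) (r : seq I) (Q : pred I) (f : I -> F) :
  (forall k, Q k -> vge v n (f k)) -> vge v n (\sum_(k <- r | Q k) f k).
Proof. by move=> vf; elim/big_ind: _ => //; [exact: vge0 | exact: vgeD]. Qed.

Lemma ord1 v : v 1 = 0.
Proof. by rewrite -(rmorph1 i) ordC. Qed.

Lemma ordV v f : v f^-1 = - v f.
Proof.
have [->|f0] := eqVneq f 0; first by rewrite invr0 Defs.ord0.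
by apply/eqP; rewrite -addr_eq0 -ordM ?invr_eq0 // mulVf // ord1.
Qed.

Lemma ordX v f k : v (f ^+ k) = k%:Z * v f.
Proof.
have [->|f0] := eqVneq f 0.
  by case: k => [|k]; rewrite ?expr0 ?ord1 ?mul0r // expr0n /= Defs.ord0 mulr0.
elim: k => [|k IHk]; first by rewrite expr0 ord1 mul0r.
by rewrite exprS ordM ?expf_neq0 // IHk; lia.
Qed.

Lemma ordZ v f (k : int) : v (f ^ k) = k * v f.
Proof.
case: k => k; first by rewrite -exprnP ordX.
by rewrite NegzE -exprnN ordV ordX; lia.
Qed.

Lemma vgeX v n f k : vge v n f -> vge v (k%:Z * n) (f ^+ k).
Proof.
move=> vf; elim: k => [|k IHk]; first by rewrite expr0 mul0r vge1.
by rewrite exprS -add1n PoszD mulrDl mul1r vgeM.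
Qed.

Lemma vgeX0 v f k : vge v 0 f -> vge v 0 (f ^+ k).
Proof. by move=> /(vgeX k); rewrite mulr0. Qed.

Lemma vgeV v f : v f <= 0 -> vge v 0 f^-1.
Proof. by move=> vf; rewrite vge_ord // ordV oppr_ge0. Qed.

Lemma vge_cancel v n f g : g != 0 -> vge v (n + v g) (f * g) -> vge v n f.
Proof.
by move=> g0; rewrite /vge mulf_eq0 (negbTE g0) orbF;
  case: eqVneq => //= f0; rewrite ordM // lerD2r.
Qed.

Lemma vge1_const v c : vge v 1 (i c) -> c = 0.
Proof.
by rewrite /vge ordC fmorph_eq0 orbF; move/eqP.
Qed.

Lemma ord_neq0 v f : v f != 0 -> f != 0.
Proof. by apply: contraNneq => ->; rewrite Defs.ord0. Qed.

(** If [f + g] had order above [v f], then [f = (f + g) - g] would have order at least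
    [Num.min n (v (f + g))], which exceeds [v f]. *)
Lemma ord_dominant v n f g :
  f != 0 -> v f < n -> vge v n g -> f + g != 0 /\ v (f + g) = v f.
Proof.
move=> f0 lt_fn vg.
have fg0 : f + g != 0.
  apply/eqP => fg0; have /(ord_vge f0) : vge v n f.
    by rewrite -[f](addrK g) fg0 sub0r vgeN.
  by rewrite leNgt lt_fn.
split=> //; apply/eqP; rewrite eq_le; apply/andP; split; last first.
  by apply: ord_vge => //; rewrite vgeD ?(vgeW _ vg) 1?ltW // vge_ord.
rewrite leNgt; apply/negP => lt_f.
have [h [lt_fh hg hfg]] : exists h, [/\ v f < h, h <= n & h <= v (f + g)].
  exists (Num.min n (v (f + g))).
  by rewrite lt_min lt_fn lt_f !ge_min !lexx orbT.
have /(ord_vge f0) : vge v h f.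
  by rewrite -[f](addrK g) vgeB ?(vgeW hg vg) // vge_ord.
by rewrite leNgt lt_fh.
Qed.

Lemma ord_unit v f c : c != 0 -> vge v 1 (f - i c) -> f != 0 /\ v f = 0.
Proof.
move=> c0 vf; have := @ord_dominant v 1 (i c) (f - i c).
by rewrite fmorph_eq0 ordC subrKC => /(_ c0 isT vf).
Qed.

Lemma vge_subC v f c : vge v 1 (f - i c) -> vge v 0 f.
Proof.
move=> vf; rewrite -[f](subrK (i c)) vgeD ?vge_const //.
exact: vgeW vf.
Qed.

(** * Values of polynomials over [L] at elements of [F] *)

Definition ev (t : F) (p : {poly L}) : F := (map_poly i p).[t].

Lemma evD t p q : ev t (p + q) = ev t p + ev t q.
Proof. by rewrite /ev rmorphD hornerD. Qed.
Lemma evM t p q : ev t (p * q) = ev t p * ev t q.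
Proof. by rewrite /ev rmorphM hornerM. Qed.
Lemma evN t p : ev t (- p) = - ev t p.
Proof. by rewrite /ev rmorphN hornerN. Qed.
Lemma evX t : ev t 'X = t.
Proof. by rewrite /ev map_polyX hornerX. Qed.
Lemma evC t c : ev t c%:P = i c.
Proof. by rewrite /ev map_polyC hornerC. Qed.
Lemma ev0 t : ev t 0 = 0.
Proof. by rewrite /ev rmorph0 horner0. Qed.
Lemma ev1 t : ev t 1 = 1.
Proof. by rewrite /ev rmorph1 hornerC. Qed.
Lemma evXn t p k : ev t (p ^+ k) = ev t p ^+ k.
Proof. by rewrite /ev rmorphXn horner_exp. Qed.
Definition evE := (evD, evM, evN, evXn, evX, ev0, ev1, evC).

Lemma ev_XsubC t c : ev t ('X - c%:P) = t - i c.
Proof. by rewrite !evE. Qed.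

Lemma ev_sum t (p : {poly L}) k : (size p <= k)%N ->
  ev t p = \sum_(l < k) i p`_l * t ^+ l.
Proof.
move=> le_pk; rewrite /ev (@horner_coef_wide _ k) ?size_map_poly //.
by apply: eq_bigr => l _; rewrite coef_map.
Qed.

Lemma vge_ev v t p : vge v 0 t -> vge v 0 (ev t p).
Proof.
move=> vt; rewrite (@ev_sum t p _ (leqnn _)) vge_sum // => l _.
by rewrite vgeM0 ?vge_const // vgeX0.
Qed.

(** The polynomial [p - p.[t0]] is divisible by [X - t0], and the quotient is regular wherever [t]
    is. *)
Lemma vge_ev_sub v n t t0 p : vge v 0 t -> vge v n (t - i t0) ->
  vge v n (ev t p - i p.[t0]).
Proof.
move=> vt vtt0.
have /factor_theorem[q def_q] : root (p - p.[t0]%:P) t0.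
  by rewrite /root !hornerE subrr.
have -> : ev t p - i p.[t0] = ev t q * (t - i t0).
  by rewrite -(evC t p.[t0]) -evN -evD def_q !evE.
by rewrite vgeM0 ?vge_ev.
Qed.

Lemma vge_ev_root v n t t0 p : vge v 0 t -> vge v n (t - i t0) ->
  root p t0 -> vge v n (ev t p).
Proof.
move=> vt vtt0 /rootP p0.
by have := vge_ev_sub p vt vtt0; rewrite p0 rmorph0 subr0.
Qed.

Lemma ev_root v t t0 p : vge v 1 (t - i t0) -> vge v 1 (ev t p) -> root p t0.
Proof.
move=> vt vp; apply/rootP/(@vge1_const v).
rewrite -[i _](subKr (ev t p)) vgeB // vge_ev_sub //.
exact: vge_subC vt.
Qed.

End Orders.

(** * The place of a discrete valuation ring *)

Section PlaceOfValuationRing.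

(* [O f c] reads: f lies in the valuation ring, with residue c; [t] is a
   uniformizer. *)
Variables (L F : fieldType) (i : {rmorphism L -> F}) (O : F -> L -> Prop).
Variable t : F.
Hypothesis t0 : t != 0.
Hypothesis OC : forall c, O (i c) c.
Hypothesis OD : forall f g a b, O f a -> O g b -> O (f + g) (a + b).
Hypothesis OM : forall f g a b, O f a -> O g b -> O (f * g) (a * b).
Hypothesis OV : forall f a, O f a -> a != 0 -> O f^-1 a^-1.
Hypothesis O1 : ~ O 1 0.
Hypothesis Ot : O t 0.
Hypothesis Odiv : forall f, O f 0 -> exists c, O (f / t) c.
Hypothesis Oden : forall f, exists (n : nat) c, O (f * t ^+ n) c.

Let OtX (n : nat) : O (t ^+ n.+1) 0.
Proof.
elim: n => [|n IHn]; first by rewrite expr1.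
by rewrite exprS -[0](mulr0 0); exact: OM.
Qed.

(** A ring element with nonzero residue is a unit, so [n] is the order of [f]. *)
Let val (f : F) (n : int) : Prop :=
  exists g c, [/\ c != 0, O g c & f = t ^ n * g].

(** Divide by [t] as long as the residue is 0; since [f / t ^+ n] has left the ring, this stops
    after fewer than [n] divisions. *)
Let val_inf (f : F) (c : L) n : O f c -> f != 0 ->
  (forall b, ~ O (f / t ^+ n) b) -> exists m : nat, val f m.
Proof.
elim: n f c => [|n IHn] f c Of f0 nO.
  by case: (nO c); rewrite expr0 divr1.
have [c0|c0] := eqVneq c 0; last first.
  by exists 0%N, f, c; rewrite expr0z mul1r.
rewrite {}c0 in Of; have [b Oft] := Odiv Of.
have [||m [g [a [a0 Og def_f]]]] := IHn _ _ Oft.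
- by rewrite mulf_neq0 ?invr_eq0.
- by move=> a; rewrite -mulrA -invfM -exprS => /nO.
- exists m.+1, g, a; split=> //.
  by rewrite -exprnP exprS -mulrA exprnP -def_f mulrCA divff ?mulr1.
Qed.

Let val_ex f : f != 0 -> exists n, val f n.
Proof.
move=> f0; have [N [c ON]] := Oden f; have [M [b OM']] := Oden f^-1.
have [|a Oa|m [g [a [a0 Og def_f]]]] := @val_inf _ _ (N + M).+1 ON.
- by rewrite mulf_neq0 ?expf_neq0.
- apply: O1; rewrite -(mul0r (a * b)).
  (* If [f * t ^+ N] stayed in the ring after [N + M + 1] divisions, this factorization would give 1
     the residue 0. *)
  have -> : 1 = t * (f * t ^+ N / t ^+ (N + M).+1 * (f^-1 * t ^+ M)).
    have := expf_neq0 N t0; have := expf_neq0 M t0.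
    by rewrite exprS exprD => ? ?; field; apply/and4P.
  exact: OM (OM _ _).
- exists (m%:Z - N%:Z), g, a; split=> //.
  by rewrite expfzDr // mulrAC -def_f -exprnN mulfK ?expf_neq0.
Qed.

(** If [m < n], the unit [g] equals a positive power of [t] times [b], so it would also have residue
    0. *)
Let val_le f g b c a m n : f != 0 -> f = t ^ m * g -> f = t ^ n * b ->
  c != 0 -> O g c -> O b a -> n <= m.
Proof.
move=> f0 def_f; rewrite def_f => E c0 Og Ob.
rewrite leNgt; apply/negP => lt_mn.
have [k def_n] : exists k : nat, n = m + k.+1.
  by exists (absz (n - m)).-1; lia.
have g0 : g != 0 by apply: contraNneq f0 => g0; rewrite def_f g0 mulr0.
apply: O1; rewrite -(mul0r c^-1) -(mulfV g0); apply: OM; last exact: OV.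
have -> : g = t ^+ k.+1 * b; last by rewrite -(mul0r a); exact: OM (OtX _) Ob.
have tm0 : t ^ m != 0 by rewrite expfz_neq0.
by apply: (mulfI tm0); rewrite E def_n expfzDr // mulrA.
Qed.

(** The exponent is picked by choice; the value 0 at [f = 0] follows the convention of [place]. *)
Let w (f : F) : int :=
  if f == 0 then 0 else epsilon (inhabits 0) (val f).

Let wP f : f != 0 -> val f (w f).
Proof.
by move=> f0; rewrite /w (negbTE f0); exact: epsilon_spec (val_ex f0).
Qed.

Let w_eq f n : f != 0 -> val f n -> w f = n.
Proof.
move=> f0 [g [a [a0 Og Eg]]]; have [h [b [b0 Oh Eh]]] := wP f0.
apply/eqP; rewrite eq_le.
by rewrite (val_le f0 Eg Eh a0 Og Oh) (val_le f0 Eh Eg b0 Oh Og).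
Qed.

Let w_unit f c : c != 0 -> O f c -> f != 0 /\ w f = 0.
Proof.
move=> c0 Of; have f0 : f != 0.
  apply/eqP => f0; apply: O1; rewrite f0 in Of.
  have /(OM (OC (- c^-1))) := Of.
  rewrite mulr0 mulNr mulVf // => O01.
  by have /(OD O01) := OC 1; rewrite add0r addNr rmorph1.
split=> //; apply: w_eq => //; exists f, c; split=> //.
by rewrite expr0z mul1r.
Qed.

Let wC c : w (i c) = 0.
Proof.
have [->|c0] := eqVneq c 0; first by rewrite /w rmorph0 eqxx.
by have [] := w_unit c0 (OC c).
Qed.

Let wM f g : f != 0 -> g != 0 -> w (f * g) = w f + w g.
Proof.
move=> f0 g0; have [h [a [a0 Oh Eh]]] := wP f0.
have [k [b [b0 Ok Ek]]] := wP g0.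
apply: w_eq; first exact: mulf_neq0.
exists (h * k), (a * b); split; [exact: mulf_neq0 | exact: OM |].
by rewrite expfzDr // {1}Eh {1}Ek mulrACA.
Qed.

(** Factoring [t ^ w f] out of the sum leaves [h + t ^ n * k] with [n] a natural number, which lies
    in the ring. *)
Let wD_le f g : f != 0 -> g != 0 -> f + g != 0 -> w f <= w g ->
  w f <= w (f + g).
Proof.
move=> f0 g0 fg0 le_fg; have [h [a [a0 Oh Eh]]] := wP f0.
have [k [b [b0 Ok Ek]]] := wP g0; have [l [c [c0 Ol El]]] := wP fg0.
have [n def_n] : exists n : nat, w g = w f + n.
  by exists (absz (w g - w f)); lia.
have [e Oe] : exists e, O (t ^+ n) e.
  by case: (n) => [|m]; [exists 1; rewrite expr0 -(rmorph1 i) | exists 0].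
apply: (val_le fg0 El _ c0 Ol (OD Oh (OM Oe Ok))).
by rewrite mulrDr -Eh mulrA exprnP -expfzDr // -def_n -Ek.
Qed.

Let wD f g : f != 0 -> g != 0 -> f + g != 0 -> Num.min (w f) (w g) <= w (f + g).
Proof.
move=> f0 g0 fg0; have [le_fg|/ltW le_gf] := leP (w f) (w g).
  exact: wD_le.
by rewrite addrC wD_le // addrC.
Qed.

Let wt : w t = 1.
Proof.
apply: w_eq => //; exists 1, 1; split; first exact: oner_neq0.
  by rewrite -{1}(rmorph1 i).
by rewrite mulr1 expr1z.
Qed.

Let w0 : w 0 = 0.
Proof. by rewrite /w eqxx. Qed.

Lemma valuation_ring_place : exists v : place i,
  [/\ v t = 1,
      forall f c, O f c -> vge v 0 f,
      forall f, vge v 0 f -> exists c, vge v 1 (f - i c) &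
      forall v' : place i, 0 < v' t ->
        (forall f c, c != 0 -> O f c -> v' f = 0) -> v' =1 v].
Proof.
exists (Place w0 wC wM wD (ex_intro _ t wt)).
split=> //= [f c Of|f|v' t_gt0 Ov' f].
- have [->|f0] := eqVneq f 0; first exact: vge0.
  apply: vge_ord => /=; have [g [b [b0 Og Eg]]] := wP f0.
  by apply: (val_le f0 Eg _ b0 Og Of); rewrite expr0z mul1r.
- have [->|f0] := eqVneq f 0.
    by exists 0; rewrite rmorph0 subr0 vge0.
  move=> /(ord_vge f0) /=; have [g [c [c0 Og def_f]]] := wP f0.
  case def_n: (w f) def_f => [[|n]|//] def_f _.
    rewrite expr0z mul1r in def_f; exists c; rewrite {}def_f.
    have [->|gc0] := eqVneq (g - i c) 0; first exact: vge0.
    apply: vge_ord => /=; have [h [b [b0 Oh Eh]]] := wP gc0.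
    have O0: O (g - i c) 0.
      by have := OD Og (OC (- c)); rewrite rmorphN subrr.
    have [e Oe] := Odiv O0; apply: (val_le gc0 Eh _ b0 Oh Oe).
    by rewrite expr1z mulrC divfK.
  by exists 0; rewrite rmorph0 subr0; apply: vge_ord => /=; rewrite def_n.
have [->|f0] := eqVneq f 0; first by rewrite !Defs.ord0.
(* Units have order 0 at [v'], so [v'] is the multiple of [w] by [v' t]; normalization then forces
   this positive factor to be 1. *)
have def_v g : g != 0 -> v' g = w g * v' t.
  move=> g0; have [h [c [c0 Oh Eh]]] := wP g0.
  have h0 : h != 0 by apply: contraNneq g0 => h0; rewrite Eh h0 mulr0.
  by rewrite {1}Eh ordM ?expfz_neq0 // ordZ (Ov' _ _ c0 Oh) addr0.
rewrite /= def_v //; have [g vg] := ord_normalized v'.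
have g0 : g != 0 by apply: (@ord_neq0 _ _ _ v'); rewrite vg.
have := def_v g g0; rewrite vg.
suff: forall a b : int, 0 < b -> 1 = a * b -> b = 1.
  by move=> H /(H _ _ t_gt0)->; rewrite mulr1.
move=> a b b0 E; have a0 : 0 < a by rewrite -(pmulr_lgt0 a b0) -E.
have : b <= a * b by apply: ler_peMl; lia.
by rewrite -E; lia.
Qed.

End PlaceOfValuationRing.

(** * Places of the curve z^2 = S(t) *)

Section DoubleCover.

Variables (L F : fieldType) (i : {rmorphism L -> F}) (t z : F) (S : {poly L}).
Local Notation "p ^t" := (ev i t p) (at level 8, format "p ^t").
Hypothesis zz : z ^+ 2 = S^t.
Hypothesis free : forall a b : {poly L}, a^t + b^t * z = 0 -> a = 0 /\ b = 0.
Hypothesis gen :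
  forall f, exists a b g : {poly L}, g != 0 /\ f * g^t = a^t + b^t * z.
Variables t0 z0 : L.
Hypothesis zz0 : z0 ^+ 2 = S.[t0].

(** The coordinate ring [L[t, z]] with evaluation at the point [(t0, z0)]. It is a relation because
    the value is read off a representation [a + b z], which [free] makes unique. *)
Definition cover_value (f : F) (c : L) : Prop := exists a b : {poly L},
  f = a^t + b^t * z /\ c = a.[t0] + b.[t0] * z0.

(** The local ring at [(t0, z0)]: fractions whose denominator does not vanish there, with their
    value. *)
Definition local_value (f : F) (c : L) : Prop := exists u w a b,
  [/\ cover_value u a, cover_value w b, b != 0, f = u / w & c = a / b].

Lemma cover_poly p : cover_value p^t p.[t0].
Proof. by exists p, 0; rewrite ev0 horner0 !mul0r !addr0. Qed.

Lemma coverC c : cover_value (i c) c.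
Proof. by have := cover_poly c%:P; rewrite evC hornerC. Qed.

Lemma cover_z : cover_value z z0.
Proof. by exists 0, 1; rewrite ev0 ev1 hornerC hornerC !mul1r !add0r. Qed.

Lemma coverD f g a b :
  cover_value f a -> cover_value g b -> cover_value (f + g) (a + b).
Proof.
move=> [p [q [-> ->]]] [p' [q' [-> ->]]]; exists (p + p'), (q + q').
by rewrite !evE !hornerD; split; ring.
Qed.

Lemma coverM f g a b :
  cover_value f a -> cover_value g b -> cover_value (f * g) (a * b).
Proof.
move=> [p [q [-> ->]]] [p' [q' [-> ->]]].
exists (p * p' + q * q' * S), (p * q' + p' * q).
by rewrite !evE !(hornerD, hornerM) -zz -zz0; split; ring.
Qed.

Lemma cover_inj f a b : cover_value f a -> cover_value f b -> a = b.
Proof.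
move=> [p [q [-> ->]]] [p' [q' [E ->]]].
have [|/eqP Ep /eqP Eq] := @free (p - p') (q - q').
  by rewrite !evE; apply/eqP; rewrite mulrBl addrACA -opprD -E subrr.
by rewrite !subr_eq0 in Ep Eq; rewrite (eqP Ep) (eqP Eq).
Qed.

Lemma cover_neq0 f a : cover_value f a -> a != 0 -> f != 0.
Proof.
move=> fa; apply: contraNneq => f0; rewrite f0 in fa; apply/eqP.
by apply: cover_inj fa _; have := coverC 0; rewrite rmorph0.
Qed.

Lemma ev_cover_neq0 p : p != 0 -> p^t != 0.
Proof.
apply: contraNneq => p0; have [|-> //] := @free p 0.
by rewrite p0 ev0 mul0r addr0.
Qed.

Lemma local_cover f a : cover_value f a -> local_value f a.
Proof.
move=> fa; exists f, (i 1), a, 1; rewrite rmorph1 !divr1 oner_neq0.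
by split=> //; rewrite -(rmorph1 i); exact: coverC.
Qed.

Lemma localC c : local_value (i c) c.
Proof. exact/local_cover/coverC. Qed.

Lemma localD f g a b :
  local_value f a -> local_value g b -> local_value (f + g) (a + b).
Proof.
move=> [u [w [c [e [uc we e0 -> ->]]]]] [u' [w' [c' [e' [uc' we' e0' -> ->]]]]].
have w0 := cover_neq0 we e0; have w0' := cover_neq0 we' e0'.
exists (u * w' + u' * w), (w * w'), (c * e' + c' * e), (e * e').
split; [exact/coverD/coverM/we/uc'/coverM | exact: coverM | exact: mulf_neq0
       | by field; apply/andP | by field; apply/andP].
Qed.

Lemma localM f g a b :
  local_value f a -> local_value g b -> local_value (f * g) (a * b).
Proof.
move=> [u [w [c [e [uc we e0 -> ->]]]]] [u' [w' [c' [e' [uc' we' e0' -> ->]]]]].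
exists (u * u'), (w * w'), (c * c'), (e * e').
by rewrite !mulf_div mulf_neq0 //; split=> //; exact: coverM.
Qed.

Lemma localX f a n : local_value f a -> local_value (f ^+ n) (a ^+ n).
Proof.
move=> fa; elim: n => [|n IHn]; last by rewrite !exprS; exact: localM.
by rewrite !expr0 -(rmorph1 i); exact: localC.
Qed.

Lemma localV f a : local_value f a -> a != 0 -> local_value f^-1 a^-1.
Proof.
move=> [u [w [c [e [uc we e0 -> ->]]]]].
rewrite mulf_eq0 negb_or => /andP[c0 _].
by exists w, u, e, c; rewrite !invf_div.
Qed.

Lemma local1 : ~ local_value 1 0.
Proof.
move=> [u [w [c [e [uc we e0 E /esym/eqP]]]]].
rewrite mulf_eq0 invr_eq0 (negbTE e0) orbF => /eqP c0.
have w0 := cover_neq0 we e0; case/eqP: e0.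
apply: cover_inj we _; rewrite -c0.
by have -> : w = u by apply: (mulIf (invr_neq0 w0)); rewrite -E divff.
Qed.

(** Any place centred at [(t0, z0)] has the values of the local ring as residues; this is the source
    of uniqueness of the place. *)
Lemma local_residue (v : place i) f c :
  vge v 1 (t - i t0) -> vge v 1 (z - i z0) -> local_value f c ->
  vge v 1 (f - i c).
Proof.
move=> vt vz.
have cv u a : cover_value u a -> vge v 1 (u - i a).
  move=> [p [q [-> ->]]].
  have -> : p^t + q^t * z - i (p.[t0] + q.[t0] * z0) =
    (p^t - i p.[t0]) + (q^t - i q.[t0]) * z + i q.[t0] * (z - i z0) by ring.
  have vt0 := vge_subC vt; have vz0 := vge_subC vz.
  apply: vgeD; last by rewrite vgeM0 ?vge_const.
  by apply: vgeD; [exact: vge_ev_sub | rewrite mulrC vgeM0 ?vge_ev_sub].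
move=> [u [w [a [b [/cv ua wb b0 -> ->]]]]].
have [w0 vw] := ord_unit b0 (cv _ _ wb).
have ib0 : i b != 0 by rewrite fmorph_eq0.
have -> : u / w - i (a / b) = ((u - i a) - i (a / b) * (w - i b)) / w.
  by rewrite fmorph_div; field; apply/andP.
rewrite mulrC vgeM0 //; first by rewrite vgeV ?vw.
by rewrite vgeB // vgeM0 ?vge_const // cv.
Qed.

(* [s] is a uniformizer at (t0, z0): it divides t - t0 and z - z0 locally. *)
Lemma smooth_point_place (s h1 h2 h3 : F) (c1 c2 c3 : L) :
    s != 0 -> local_value s 0 ->
    local_value h1 c1 -> t - i t0 = s * h1 ->
    local_value h2 c2 -> z - i z0 = s * h2 ->
    local_value h3 c3 -> s ^+ 2 = (t - i t0) * h3 ->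
  exists v : place i,
  [/\ v s = 1, vge v 1 (t - i t0), vge v 1 (z - i z0),
      forall f, vge v 0 f -> exists c, vge v 1 (f - i c) &
      forall v' : place i, vge v' 1 (t - i t0) -> vge v' 1 (z - i z0) ->
        v' =1 v].
Proof.
move=> s0 Os Oh1 Et Oh2 Ez Oh3 Es.
have Odiv f : local_value f 0 -> exists c, local_value (f / s) c.
  move=> [u [w [c [e [[p [q [Eu Ec]] we e0 -> /esym/eqP]]]]]].
  rewrite mulf_eq0 invr_eq0 (negbTE e0) orbF => /eqP c0.
  have /factor_theorem[p' Ep] : root (p - p.[t0]%:P) t0.
    by rewrite /root !hornerE subrr.
  have /factor_theorem[q' Eq] : root (q - q.[t0]%:P) t0.
    by rewrite /root !hornerE subrr.
  (* Since [u = p + q z] vanishes at the point, [p.[t0] = - q.[t0] * z0], hence [u = (t - t0) (p' +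
     q' z) + q.[t0] (z - z0)], and both differences are multiples of [s]. *)
  have -> : u / w / s = (h1 * (p'^t + q'^t * z) + i q.[t0] * h2) * w^-1.
    rewrite mulrAC; congr (_ / _); apply: (canLR (mulfK s0)).
    have := congr1 (ev i t) Ep; have := congr1 (ev i t) Eq; rewrite !evE.
    move/eqP; rewrite subr_eq => /eqP Eq' /eqP; rewrite subr_eq => /eqP Ep'.
    have E0 : i p.[t0] = - (i q.[t0] * i z0).
      by apply/eqP; rewrite -addr_eq0 -rmorphM -rmorphD -Ec c0 rmorph0.
    transitivity (s * h1 * (p'^t + q'^t * z) + i q.[t0] * (s * h2)); last first.
      by ring.
    by rewrite -Et -Ez Eu Ep' Eq' E0; ring.
  have Op p0 := local_cover (cover_poly p0).
  have Oz := local_cover cover_z; have Oq := localC q.[t0].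
  have Ow := localV (local_cover we) e0.
  eexists; apply: localM Ow; apply: localD; apply: localM; try by eassumption.
  by apply: localD (Op p') _; apply: localM (Op q') Oz.
have Oden f : exists (n : nat) c, local_value (f * s ^+ n) c.
  have [p [q [g [g0 Ef]]]] := gen f.
  have [e [g1 g1t0 Eg]] := multiplicity_XsubC g t0.
  rewrite g0 /= in g1t0.
  have Og := localV (local_cover (cover_poly g1)) g1t0.
  have := localM (localX e Oh3) (localM _ Og) => /(_ (p^t + q^t * z) _ _) O'.
  (* The denominator is [(t - t0) ^+ e * g1] with [g1] a unit, and [s ^+ 2] is a local multiple of
     [t - t0], so [s ^+ (2 * e)] clears it. *)
  exists (2 * e)%N; eexists.
  have -> : f * s ^+ (2 * e) = h3 ^+ e * ((p^t + q^t * z) / g1^t); last first.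
    apply: O'; apply: local_cover.
    exact: coverD (cover_poly p) (coverM (cover_poly q) cover_z).
  rewrite -Ef Eg !evE exprM Es exprMn.
  have : g1^t != 0 by apply: cover_neq0 (cover_poly g1) g1t0.
  by move=> g1t; field.
have [v [vs Ov res uniq]] :=
  valuation_ring_place s0 localC localD localM localV local1 Os Odiv Oden.
exists v; split=> //.
- by rewrite Et mulrC -[1]add0r vgeM ?(Ov _ _ Oh1) // vge_ord ?vs.
- by rewrite Ez mulrC -[1]add0r vgeM ?(Ov _ _ Oh2) // vge_ord ?vs.
move=> v' v't v'z; apply: uniq => [|f c c0 Of].
  by have := local_residue v't v'z Os; rewrite rmorph0 subr0 => /(ord_vge s0).
by have [] := ord_unit c0 (local_residue v't v'z Of).
Qed.

(** The product [(z - z0) (z + z0) = S(t) - S(t0)] is divisible by [t - t0], and [z + z0] has value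
    [2 z0], a nonzero constant. So [t - t0] is a uniformizer. *)
Lemma unramified_place : z0 != 0 -> 2%:R != 0 :> L -> exists v : place i,
  [/\ v (t - i t0) = 1, vge v 1 (z - i z0),
      forall f, vge v 0 f -> exists c, vge v 1 (f - i c) &
      forall v' : place i, vge v' 1 (t - i t0) -> vge v' 1 (z - i z0) ->
        v' =1 v].
Proof.
move=> z00 two0.
have /factor_theorem[S1 ES] : root (S - S.[t0]%:P) t0.
  by rewrite /root !hornerE subrr.
have cz : cover_value (z + i z0) (z0 + z0) by exact: coverD cover_z (coverC z0).
have zz00 : z0 + z0 != 0 by rewrite -mulr2n -mulr_natl mulf_neq0.
have zz1 := cover_neq0 cz zz00.
have ct : cover_value (t - i t0) 0.
  rewrite -(subrr t0) -{1}(evX i t) -rmorphN -{2}(hornerX t0).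
  exact: coverD (cover_poly 'X) (coverC _).
have ttE : t - i t0 = ('X - t0%:P)^t by rewrite !evE.
have tt0 : t - i t0 != 0 by rewrite ttE ev_cover_neq0 // polyXsubC_eq0.
have Oh := localM (local_cover (cover_poly S1)) (localV (local_cover cz) zz00).
have [||||v [vt _ vz res uniq]] := @smooth_point_place
  (t - i t0) 1 _ (t - i t0) 1 _ 0 tt0 (local_cover ct) _ _ Oh _ (local_cover ct).
- by rewrite -{1}(rmorph1 i); exact: localC.
- by rewrite mulr1.
- apply: (mulIf zz1); rewrite mulrA divfK // -subr_sqr zz -rmorphXn zz0.
  by rewrite ttE -evM mulrC -ES !evE.
- by rewrite expr2.
by exists v.
Qed.

(** From [z ^+ 2 = S1(t) (t - t0)] with [S1(t)] a unit, [t - t0] is [z] times [z / S1(t)], so [z] is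
    a uniformizer. *)
Lemma ramified_place S1 : z0 = 0 -> S = S1 * ('X - t0%:P) -> S1.[t0] != 0 ->
  exists v : place i,
  [/\ v z = 1, vge v 1 (t - i t0),
      forall f, vge v 0 f -> exists c, vge v 1 (f - i c) &
      forall v' : place i, vge v' 1 (t - i t0) -> vge v' 1 z -> v' =1 v].
Proof.
move=> z00 ES S10.
have zn0 : z != 0.
  apply/eqP => z1; have [|_ /eqP] := @free 0 1; last by rewrite oner_eq0.
  by rewrite z1 ev0 mulr0 addr0.
have cz : local_value z 0 by rewrite -z00; exact: local_cover cover_z.
have cS := local_cover (cover_poly S1).
have S1t0 := cover_neq0 (cover_poly S1) S10.
have [||||v [vs vt _ res uniq]] := @smooth_point_place
  z _ 1 S1^t _ 1 _ zn0 cz (localM cz (localV cS S10)) _ _ _ cS.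
- by rewrite mulrA -expr2 zz ES !evE mulrAC divff // mul1r.
- by rewrite -{1}(rmorph1 i); exact: localC.
- by rewrite z00 rmorph0 subr0 mulr1.
- by rewrite zz ES !evE mulrC.
exists v; split=> // v' v't v'z; apply: uniq => //.
by rewrite z00 rmorph0 subr0.
Qed.

End DoubleCover.

(** * The function field of the Edwards curve as a double cover *)

Section FunctionField.

Variables (L F : fieldType) (i : {rmorphism L -> F}) (x y : F) (d : L).
Hypothesis funF : is_function_field i x y (edwards_poly d).
Local Notation "p ^y" := (ev i y p) (at level 8, format "p ^y").

Lemma eval2D u w : eval2 i x y (u + w) = eval2 i x y u + eval2 i x y w.
Proof. by rewrite /eval2 rmorphD !hornerD. Qed.
Lemma eval2M u w : eval2 i x y (u * w) = eval2 i x y u * eval2 i x y w.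
Proof. by rewrite /eval2 rmorphM !hornerM. Qed.
Lemma eval2N u : eval2 i x y (- u) = - eval2 i x y u.
Proof. by rewrite /eval2 rmorphN !hornerN. Qed.
Lemma eval2X : eval2 i x y 'X = x.
Proof. by rewrite /eval2 map_polyX hornerX hornerC. Qed.
Lemma eval2C p : eval2 i x y p%:P = p^y.
Proof. by rewrite /eval2 map_polyC hornerC. Qed.
Lemma eval2Xn u n : eval2 i x y (u ^+ n) = eval2 i x y u ^+ n.
Proof. by rewrite /eval2 rmorphXn !horner_exp. Qed.
Lemma eval2_1 : eval2 i x y 1 = 1.
Proof. by rewrite eval2C ev1. Qed.
Lemma eval2_0 : eval2 i x y 0 = 0.
Proof. by rewrite eval2C ev0. Qed.
Definition eval2E :=
  (eval2D, eval2M, eval2N, eval2Xn, eval2X, eval2_1, eval2_0, eval2C).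

Lemma function_field_eq : x ^+ 2 + y ^+ 2 = 1 + i d * x ^+ 2 * y ^+ 2.
Proof.
have [_ H] := ff_relations funF (edwards_poly d).
have /H : exists w, edwards_poly d = w * edwards_poly d.
  by exists 1; rewrite mul1r.
rewrite /edwards_poly !eval2E !evE => /eqP.
by rewrite subr_eq0 => /eqP ->.
Qed.

Lemma edwards_sq : x ^+ 2 * (1 - i d * y ^+ 2) = 1 - y ^+ 2.
Proof.
have E := function_field_eq; apply/eqP; rewrite -subr_eq0; apply/eqP.
transitivity (x ^+ 2 + y ^+ 2 - (1 + i d * x ^+ 2 * y ^+ 2)); first by ring.
by rewrite E subrr.
Qed.

(* Locked: otherwise rewriting with [evE] would unfold them. *)
Definition denom : {poly L} := locked (1 - d%:P * 'X ^+ 2).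
Definition quartic : {poly L} := locked ((1 - 'X ^+ 2) * denom).
Local Notation z := (x * denom^y).

Lemma ev_denom : denom^y = 1 - i d * y ^+ 2.
Proof. by rewrite /denom -lock !evE. Qed.

Lemma denom_neq0 : denom != 0.
Proof.
apply/eqP => /(congr1 (fun p : {poly L} => p`_0)) /eqP.
by rewrite /denom -lock coefB coefCM coefXn coef1 coef0 mulr0 subr0 oner_eq0.
Qed.

Lemma edwards_cover : z ^+ 2 = quartic^y.
Proof.
rewrite /quartic -lock !evE ev_denom exprMn [_ ^+ 2 in X in _ * X]expr2 mulrA.
by rewrite edwards_sq.
Qed.

Lemma size_edwards : size (edwards_poly d) = 3%N.
Proof.
have -> : edwards_poly d = denom%:P * 'X^2 + ('X ^+ 2 - 1)%:P.
  rewrite /edwards_poly /denom -lock !(polyCB, polyCM, polyC_exp, polyC1); ring.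
rewrite size_polyDl size_Cmul ?denom_neq0 ?size_polyXn //.
by rewrite (leq_ltn_trans (size_polyC_leq1 _)).
Qed.

(** The relation is a polynomial of degree at most 1 in [X] over [L[Y]], whereas a nonzero multiple
    of the Edwards polynomial has degree at least 2 in [X]. *)
Lemma function_field_free (a b : {poly L}) :
  a^y + b^y * z = 0 -> a = 0 /\ b = 0.
Proof.
move=> E; have [H _] := ff_relations funF (a%:P + (b * denom)%:P * 'X).
case: H => [|w]; first by rewrite !eval2E !evE -E; ring.
have [->|w0] := eqVneq w 0; last first.
  move/(congr1 (fun p : {poly {poly L}} => size p)).
  rewrite size_mul // -?size_poly_eq0 ?size_edwards // => Es.
  have : (size (a%:P + (b * denom)%:P * 'X)%R <= 2)%N.
    rewrite (leq_trans (size_polyD _ _)) // geq_max.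
    rewrite (leq_trans (size_polyC_leq1 _)) //=.
    rewrite (leq_trans (size_polyMleq _ _)) //.
    by rewrite size_polyX addn2 ltnS size_polyC_leq1.
  rewrite Es; move: w0; rewrite -size_poly_gt0.
  by case: (size w) => // n; rewrite addn3.
rewrite mul0r => E0.
have := congr1 (fun p : {poly {poly L}} => p`_0) E0.
have := congr1 (fun p : {poly {poly L}} => p`_1) E0.
rewrite !(coefD, coefMX, coefC, coef0) /= add0r addr0 => /eqP.
by rewrite mulf_eq0 (negbTE denom_neq0) orbF => /eqP-> ->.
Qed.

Lemma eval2_cover u : exists (n : nat) (a b : {poly L}),
  eval2 i x y u * (denom ^+ n)^y = a^y + b^y * z.
Proof.
elim/poly_ind: u => [|u c [n [a [b E]]]].
  by exists 0%N, 0, 0; rewrite eval2_0 ev0 !mul0r addr0.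
(* Horner step: the extra factor [denom] turns the new [x] into [z], and
   [(a + b z) z = b * quartic + a z]. *)
exists n.+1, (b * quartic + c * denom ^+ n.+1), a.
rewrite exprSr !evM !evD !evM evXn eval2D eval2M eval2X eval2C -edwards_cover.
rewrite evXn in E.
transitivity ((eval2 i x y u * denom^y ^+ n) * z + c^y * denom^y ^+ n.+1).
  by rewrite exprSr; ring.
by rewrite E exprSr; ring.
Qed.

Lemma function_field_gen f : exists a b g : {poly L},
  g != 0 /\ f * g^y = a^y + b^y * z.
Proof.
have [u [w [w0 Ef]]] := ff_fractions funF f.
have [n [a [b Eu]]] := eval2_cover u.
have [m [a' [b' Ew]]] := eval2_cover w.
have den0 k : (denom ^+ k)^y != 0.
  apply/eqP => E; have [|/eqP] := @function_field_free (denom ^+ k) 0.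
    by rewrite E ev0 mul0r addr0.
  by rewrite expf_eq0 (negbTE denom_neq0) andbF.
have Nw0 : a'^y + b'^y * z != 0 by rewrite -Ew mulf_neq0.
(* The denominator [a' + b' z] is rationalized by its conjugate [a' - b' z]; the norm is nonzero
   because both factors are, by freeness. *)
exists ((a * a' - b * b' * quartic) * denom ^+ m).
exists ((b * a' - a * b') * denom ^+ m).
exists ((a' ^+ 2 - b' ^+ 2 * quartic) * denom ^+ n); split.
  rewrite mulf_eq0 negb_or expf_eq0 (negbTE denom_neq0) andbF andbT.
  apply/eqP => /(congr1 (ev i y)).
  rewrite !evE -edwards_cover -exprMn subr_sqr => /eqP.
  rewrite mulf_eq0 (negbTE Nw0) orbF => /eqP E0.
  have [|a0 /eqP] := @function_field_free a' (- b'); first by rewrite evN mulNr.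
  rewrite oppr_eq0 => /eqP b0; case/eqP: Nw0.
  by rewrite a0 b0 !ev0 mul0r addr0.
have fW : f * eval2 i x y w = eval2 i x y u by rewrite Ef divfK.
rewrite !(evM _ _ _ (denom ^+ _)).
move: (denom ^+ n)^y (denom ^+ m)^y Eu Ew => dn dm Eu Ew.
rewrite !evE -edwards_cover.
transitivity (f * (eval2 i x y w * dm) * (a'^y - b'^y * z) * dn).
  by rewrite Ew; ring.
transitivity (eval2 i x y u * dn * (a'^y - b'^y * z) * dm).
  by rewrite -fW; ring.
by rewrite Eu; ring.
Qed.

End FunctionField.

(** The equation is symmetric, so every result on [y] yields one on [x], in particular at the places
    where [y] has a pole. *)
Lemma function_field_swap (L F : fieldType) (i : {rmorphism L -> F}) x y d :
  is_function_field i x y (edwards_poly d) ->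
  is_function_field i y x (edwards_poly d).
Proof.
have swapE u : eval2 i y x u = eval2 i x y (swapXY u).
  by rewrite /eval2 -swapXY_map horner2_swapXY.
have swapP : swapXY (edwards_poly d) = edwards_poly d.
  have sq u : swapXY (u ^+ 2) = swapXY u ^+ 2 by rewrite rmorphXn.
  have mul u w : swapXY (u * w) = swapXY u * swapXY w by rewrite rmorphM.
  rewrite /edwards_poly raddfB !raddfD /= !(sq, mul) rmorph1.
  by rewrite !swapXY_X !swapXY_Y swapXY_polyC map_polyC /=; ring.
case=> rel frac; split=> [u|f].
  rewrite swapE; split=> [/rel[w E]|[w ->]].
    by exists (swapXY w); rewrite -[u]swapXYK E rmorphM /= swapP.
  by apply/rel; exists (swapXY w); rewrite rmorphM /= swapP.
have [u [w [w0 ->]]] := frac f.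
by exists (swapXY u), (swapXY w); rewrite !swapE !swapXYK.
Qed.

(** * Places of the Edwards curve *)

Lemma ord_ev_unit (L F : fieldType) (i : {rmorphism L -> F}) (v : place i)
    (t : F) (t0 : L) (p : {poly L}) :
  vge v 1 (t - i t0) -> ~~ root p t0 -> ev i t p != 0 /\ v (ev i t p) = 0.
Proof.
move=> vt; rewrite /root => p0; apply: (ord_unit p0).
by apply: vge_ev_sub => //; exact: vge_subC vt.
Qed.

Section EdwardsPlaces.

Variables (L F : fieldType) (i : {rmorphism L -> F}) (x y : F) (d : L).
Hypothesis funF : is_function_field i x y (edwards_poly d).
Hypotheses (two0 : 2%:R != 0 :> L) (d0 : d != 0) (d1 : d != 1).
Local Notation z := (x * ev i y (denom d)).

Lemma horner_denom t : (denom d).[t] = 1 - d * t ^+ 2.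
Proof. by rewrite /denom -lock !hornerE. Qed.

Lemma horner_quartic t : (quartic d).[t] = (1 - t ^+ 2) * (1 - d * t ^+ 2).
Proof. by rewrite /quartic -lock hornerM horner_denom !hornerE. Qed.

(** If [d * p.2 ^+ 2 = 1], the equation reduces to [p.2 ^+ 2 = 1], whence [d = 1]. *)
Lemma on_edwards_denom p : on_edwards d p -> d * p.2 ^+ 2 != 1.
Proof.
move=> E; apply: contraNneq d1 => E1; rewrite -E1.
have y1 : p.2 ^+ 2 = 1.
  apply: (addrI (p.1 ^+ 2)); rewrite E.
  by transitivity (1 + p.1 ^+ 2 * (d * p.2 ^+ 2)); [ring | rewrite E1; ring].
by rewrite y1 mulr1.
Qed.

Lemma on_edwards_swap a b : on_edwards d (a, b) -> on_edwards d (b, a).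
Proof. by rewrite /on_edwards /= addrC => ->; ring. Qed.

Lemma on_edwards_sq a b : on_edwards d (a, b) ->
  a ^+ 2 * (1 - d * b ^+ 2) = 1 - b ^+ 2.
Proof.
rewrite /on_edwards /= => E; apply/eqP; rewrite -subr_eq0; apply/eqP.
transitivity (a ^+ 2 + b ^+ 2 - (1 + d * a ^+ 2 * b ^+ 2)); first by ring.
by rewrite E subrr.
Qed.

(** This is the place of the double cover at [t = y0], [z = x0 (1 - d y0^2)]. As [denom] is a unit
    there, [x - x0] vanishes if and only if [z - z0] does, and at [x0 = 0] the uniformizer [z] may
    be replaced by [x]. *)
Lemma edwards_place x0 y0 : on_edwards d (x0, y0) -> exists v : place i,
  [/\ vge v 1 (x - i x0) /\ vge v 1 (y - i y0),
      (x0 != 0 -> v (y - i y0) = 1) /\ (x0 = 0 -> v x = 1),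
      forall f, vge v 0 f -> exists c, vge v 1 (f - i c) &
      forall v' : place i, vge v' 1 (x - i x0) -> vge v' 1 (y - i y0) ->
        v' =1 v].
Proof.
move=> on0; have /= dy0 := on_edwards_denom on0.
have E0 := on_edwards_sq on0; set e0 := 1 - d * y0 ^+ 2 in E0.
have e00 : e0 != 0 by rewrite subr_eq0 eq_sym.
have den0 : ~~ root (denom d) y0 by rewrite /root horner_denom.
have zz0 : (x0 * e0) ^+ 2 = (quartic d).[y0].
  by rewrite horner_quartic -/e0 -E0; ring.
have zE : z - i (x0 * e0) = (x - i x0) * ev i y (denom d)
    + i x0 * (ev i y (denom d) - i e0) by rewrite rmorphM; ring.
have denE (v : place i) :
    vge v 1 (y - i y0) -> vge v 1 (ev i y (denom d) - i e0).
  move=> vy; rewrite /e0 -horner_denom vge_ev_sub //; exact: vge_subC vy.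
have v'z (v : place i) : vge v 1 (x - i x0) -> vge v 1 (y - i y0) ->
    vge v 1 (z - i (x0 * e0)).
  move=> vx vy; rewrite zE vgeD //; last by rewrite vgeM0 ?vge_const ?denE.
  by rewrite mulrC vgeM0 // vge_ev //; exact: vge_subC vy.
have vx (v : place i) : vge v 1 (z - i (x0 * e0)) -> vge v 1 (y - i y0) ->
    vge v 1 (x - i x0).
  move=> vz vy; have [de0 vde] := ord_ev_unit vy den0.
  apply: (vge_cancel de0); rewrite vde addr0.
  rewrite -[_ * _](addrK (i x0 * (ev i y (denom d) - i e0))) -zE vgeB //.
  by rewrite vgeM0 ?vge_const ?denE.
have free := @function_field_free _ _ _ _ _ _ funF.
have gen := @function_field_gen _ _ _ _ _ _ funF.
have zz := edwards_cover funF.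
have [x00|x00] := eqVneq x0 0; last first.
  have z00 : x0 * e0 != 0 by rewrite mulf_neq0.
  have [v [vy vz res uniq]] := unramified_place zz free gen zz0 z00 two0.
  have vy1 : vge v 1 (y - i y0) by rewrite vge_ord ?vy.
  exists v; split=> //; first by split=> //; exact: vx.
    by split=> // /eqP; rewrite (negbTE x00).
  by move=> v' v'x v'y; apply: uniq => //; exact: v'z.
have y02 : y0 ^+ 2 = 1.
  by apply/eqP; rewrite eq_sym -subr_eq0 -E0 x00 expr0n mul0r.
have y00 : y0 != 0.
  by apply: contra_eq_neq y02 => ->; rewrite expr0n eq_sym oner_neq0.
have z00 : x0 * e0 = 0 by rewrite x00 mul0r.
(* Here [y0 ^+ 2 = 1], so [1 - X^2 = - (X + y0) (X - y0)], and the cofactor of [X - y0] in [quartic]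
   is nonzero at [y0]. *)
have [||v [vz vy res uniq]] :=
  ramified_place (S1 := - ('X + y0%:P) * denom d) zz free gen zz0 z00.
- rewrite /quartic -lock -[1 - 'X ^+ 2]opprB.
  have -> : 'X ^+ 2 - 1 = ('X + y0%:P) * ('X - y0%:P) :> {poly L}.
    by rewrite mulrC -subr_sqr -polyC_exp y02.
  by rewrite !mulNr mulrAC.
- rewrite hornerM horner_denom hornerN hornerD hornerX hornerC mulf_neq0 //.
  by rewrite oppr_eq0 -mulr2n -mulr_natl mulf_neq0.
have [de0 vde] := ord_ev_unit vy den0.
have zn0 : z != 0 by apply: (@ord_neq0 _ _ _ v); rewrite vz.
have x0' : x != 0 by apply: contraNneq zn0 => ->; rewrite mul0r.
exists v; split=> //.
- by split=> //; apply: vx => //; rewrite z00 rmorph0 subr0 vge_ord ?vz.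
- split=> [//|_].
  by have := vz; rewrite ordM // vde addr0.
move=> v' v'x v'y; apply: uniq => //.
by rewrite -[z]subr0 -(rmorph0 i) -z00 v'z.
Qed.

(** Such a [y0] is a branch point, where [z] has order 1 and [y - y0] order 2. Since [denom] has a
    simple root at [y0], [x = z / denom(y)] has order [1 - 2 = -1]. *)
Lemma edwards_place_infty y0 : d * y0 ^+ 2 = 1 ->
  exists v : place i, v x = -1 /\ v (y - i y0) = 2.
Proof.
move=> dy0; have y00 : y0 != 0.
  by apply: contra_eq_neq dy0 => ->; rewrite expr0n mulr0 eq_sym oner_neq0.
have free := @function_field_free _ _ _ _ _ _ funF.
have gen := @function_field_gen _ _ _ _ _ _ funF.
have zz := edwards_cover funF.
have denE : denom d = - (d%:P * ('X + y0%:P)) * ('X - y0%:P).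
  rewrite /denom -lock -(polyC1 L) -dy0 polyCM polyC_exp; ring.
have zz0 : 0 ^+ 2 = (quartic d).[y0].
  by rewrite horner_quartic dy0 subrr mulr0 expr0n.
have yy0 : y0 + y0 != 0 by rewrite -mulr2n -mulr_natl mulf_neq0.
have y02 : 1 - y0 ^+ 2 != 0.
  rewrite subr_eq0; apply: contra d1 => /eqP E.
  by rewrite -dy0 -E mulr1.
pose S1 := - (1 - 'X ^+ 2) * (d%:P * ('X + y0%:P)).
have S10 : ~~ root S1 y0.
  rewrite /root /S1 !(hornerM, hornerN, hornerD, horner_exp, hornerC, hornerX).
  by rewrite !mulf_neq0 // oppr_eq0.
have ES : quartic d = S1 * ('X - y0%:P).
  by rewrite /quartic -lock denE /S1 !(mulNr, mulrN) mulrA.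
have [v [vz vy res uniq]] := ramified_place zz free gen zz0 erefl ES S10.
have [s0 vs] := ord_ev_unit vy S10.
have zn0 : z != 0 by apply: (@ord_neq0 _ _ _ v); rewrite vz.
have zE : z ^+ 2 = ev i y S1 * (y - i y0) by rewrite zz ES evM ev_XsubC.
have yn0 : y - i y0 != 0.
  apply: contra_neq zn0 => E; apply/eqP; move/eqP: zE; rewrite E mulr0.
  by rewrite expf_eq0.
have vy2 : v (y - i y0) = 2.
  by have := congr1 v zE; rewrite ordX vz ordM // vs add0r => <-.
exists v; split=> //.
have [q0 vq] : ev i y (- (d%:P * ('X + y0%:P))) != 0 /\
    v (ev i y (- (d%:P * ('X + y0%:P)))) = 0.
  apply: ord_ev_unit vy _.
  by rewrite /root hornerN hornerM hornerD !hornerC hornerX oppr_eq0 mulf_neq0.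
have x0 : x != 0 by apply: contraNneq zn0 => ->; rewrite mul0r.
have := vz; rewrite denE evM ev_XsubC !ordM ?mulf_neq0 // vq vy2.
by move=> /(canRL (addrK _)) ->.
Qed.

End EdwardsPlaces.

(** * A function with at most one simple pole is constant *)

Lemma vge1_inj (L F : fieldType) (i : {rmorphism L -> F}) (v : place i) f c c' :
  vge v 1 (f - i c) -> vge v 1 (f - i c') -> c = c'.
Proof.
move=> vc vc'; apply/eqP; rewrite -subr_eq0; apply/eqP/(@vge1_const _ _ _ v).
have -> : i (c - c') = (f - i c') - (f - i c) by rewrite rmorphB; ring.
exact: vgeB.
Qed.

Lemma lies_above_vge (L F : fieldType) (i : {rmorphism L -> F}) (v : place i)
    x y p : lies_above x y p v ->
  vge v 1 (x - i p.1) /\ vge v 1 (y - i p.2).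
Proof. by case/andP => vx vy; split; apply: vge_ord. Qed.

Lemma closed_sqrt (L : closedFieldType) (c : L) : exists r, r ^+ 2 = c.
Proof.
have /closed_rootP[r] : size ('X^2 - c%:P) != 1%N by rewrite size_XnsubC.
rewrite /root !hornerE subr_eq0 => /eqP; by exists r.
Qed.

Lemma add_sub_eq0 (L : fieldType) (a b : L) : 2%:R != 0 :> L ->
  a + b = 0 -> a - b = 0 -> a = 0 /\ b = 0.
Proof.
move=> two0 E1 E2; have Ea : 2%:R * a = 0.
  by transitivity ((a + b) + (a - b)); [ring | rewrite E1 E2 addr0].
move/eqP: Ea; rewrite mulf_eq0 (negbTE two0) => /eqP a0.
by split=> //; rewrite a0 add0r in E1.
Qed.

Lemma vge_ev_pole (L F : fieldType) (i : {rmorphism L -> F}) (v : place i) t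
    (p : {poly L}) n :
  v t = -1 -> (size p <= n.+1)%N -> vge v (- n%:Z) (ev i t p).
Proof.
move=> vt le_pn; rewrite (ev_sum _ _ le_pn) vge_sum // => l _.
by rewrite vgeM0 ?vge_const // vge_ord // ordX vt mulrN1 lerN2 lez_nat -ltnS.
Qed.

Section NoSimplePole.

Variables (L : closedFieldType) (F : fieldType) (i : {rmorphism L -> F}).
Variables (x y : F) (d : L).
Hypothesis funF : is_function_field i x y (edwards_poly d).
Hypotheses (two0 : 2%:R != 0 :> L) (d0 : d != 0) (d1 : d != 1).
Variables (a b : L) (f : F).
Hypothesis onP : on_edwards d (a, b).
Hypothesis f_reg : forall v : place i, ~~ lies_above x y (a, b) v -> vge v 0 f.
Hypothesis f_pole : forall v : place i, vge v (-1) f.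
Local Notation "p ^y" := (ev i y p) (at level 8, format "p ^y").

Let two_roots : exists t : L,
  [/\ d * t ^+ 2 = 1, d * (- t) ^+ 2 = 1 & t != - t].
Proof.
have [t Et] := closed_sqrt d^-1; exists t.
rewrite sqrrN Et mulfV //; split=> //.
rewrite -subr_eq0 opprK -mulr2n -mulr_natl mulf_neq0 //.
by apply: contraNneq d0 => t0; rewrite -invr_eq0 -Et t0 expr0n.
Qed.

(** Here [(y - t) (y + t) = y^2 - 1 = - (1 - d y^2) x^2], and [y + t] is a unit because its residue
    is [2 t]. *)
Lemma vge2_axis (v : place i) t :
  t ^+ 2 = 1 -> vge v 1 x -> vge v 1 (y - i t) ->
  vge v 2 (y - i t).
Proof.
move=> t2 vx vy; have t0 : t != 0.
  by apply: contra_eq_neq t2 => ->; rewrite expr0n eq_sym oner_neq0.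
have [yt0 vyt] : y + i t != 0 /\ v (y + i t) = 0.
  apply: (@ord_unit _ _ _ _ _ (t + t)); last by rewrite rmorphD addrKA.
  by rewrite -mulr2n -mulr_natl mulf_neq0.
have vy0 := vge_subC vy.
apply: (vge_cancel yt0); rewrite vyt addr0 -subr_sqr -rmorphXn t2 rmorph1.
have -> : y ^+ 2 - 1 = - ((1 - i d * y ^+ 2) * x ^+ 2).
  by rewrite mulrC (edwards_sq funF) opprB.
rewrite vgeN // vgeM0 //; last by have := vgeX 2 vx.
by rewrite vgeB ?vge1 ?vgeM0 ?vge_const ?vgeX0.
Qed.

(** * Functions [(p(y) + q(y) x) / g(y)] in lowest terms *)

Section Representation.

Variables (p q g : {poly L}).
Hypothesis g0 : g != 0.
Hypothesis fE : f * g^y = p^y + q^y * x.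
(* [f] is written in lowest terms. *)
Hypothesis coprime_pqg : forall t, root g t -> root p t -> root q t -> False.

Let eval_at (v : place i) x0 y0 : vge v 1 (x - i x0) -> vge v 1 (y - i y0) ->
  vge v 1 (f * g^y) -> p.[y0] + q.[y0] * x0 = 0.
Proof.
move=> vx vy; rewrite fE => vf; apply: (@vge1_const _ _ _ v).
have vy0 := vge_subC vy.
have -> : i (p.[y0] + q.[y0] * x0) = p^y + q^y * x -
  ((p^y - i p.[y0]) + (q^y - i q.[y0]) * x + i q.[y0] * (x - i x0)).
  by rewrite rmorphD rmorphM; ring.
apply: vgeB => //; apply: vgeD; last by rewrite vgeM0 ?vge_const.
apply: vgeD; first exact: vge_ev_sub.
by rewrite mulrC vgeM0 ?vge_ev_sub //; exact: vge_subC vx.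
Qed.

Let axis_p (v : place i) t : t ^+ 2 = 1 -> vge v 1 x -> vge v 1 (y - i t) ->
  vge v 1 (f * g^y) -> root p t.
Proof.
move=> t2 vx vy /(@eval_at _ 0 t).
by rewrite rmorph0 subr0 mulr0 addr0 => /(_ vx vy)/rootP.
Qed.

(** A root of [p] at [t] contributes order 2, because [y - t] has order at least 2. So [q(y) x] has
    order at least 2, of which [x] accounts for only 1. *)
Let axis_q (v : place i) t : t ^+ 2 = 1 -> v x = 1 -> vge v 1 (y - i t) ->
  vge v 2 (f * g^y) -> root p t /\ root q t.
Proof.
move=> t2 vx vy vf; have vx1 : vge v 1 x by rewrite vge_ord ?vx.
have rp : root p t by apply: axis_p vx1 vy (vgeW _ vf).
split=> //; apply: (ev_root vy); have x0 : x != 0.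
  by apply: (@ord_neq0 _ _ _ v); rewrite vx.
apply: (vge_cancel x0); rewrite vx.
have -> : q^y * x = f * g^y - p^y by rewrite fE; ring.
apply: vgeB => //; apply: vge_ev_root rp; first exact: vge_subC vy.
exact: vge2_axis.
Qed.

(** At a pole of [x] the function [q(y) = (f g(y) - p(y)) / x] vanishes. If [g] vanished too, then
    [f g(y)] and [q(y) x] would have positive order, the latter at least [2 - 1], and [p] would
    share the root. *)
Let infty_q t : d * t ^+ 2 = 1 -> root q t /\ ~~ root g t.
Proof.
move=> dt; have [v [vx vy]] := edwards_place_infty funF two0 d0 d1 dt.
have x0 : x != 0 by apply: (@ord_neq0 _ _ _ v); rewrite vx.
have vf : vge v 0 f.
  apply: f_reg; apply/negP => /lies_above_vge[/vge_subC/(ord_vge x0)].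
  by rewrite vx.
have vy1 : vge v 1 (y - i t) by rewrite vge_ord ?vy.
have vy2 : vge v 2 (y - i t) by rewrite vge_ord ?vy.
have vy0 := vge_subC vy1.
have vxV : vge v 1 x^-1 by rewrite vge_ord // ordV vx.
have rq : root q t.
  apply: (ev_root vy1); have -> : q^y = (f * g^y - p^y) * x^-1.
    by rewrite fE addrAC subrr add0r mulfK.
  by rewrite vgeM0 // vgeB ?vgeM0 ?vge_ev.
split=> //; apply/negP => rg; apply: (coprime_pqg rg _ rq).
apply: (ev_root vy1); have -> : p^y = f * g^y - q^y * x by rewrite fE; ring.
apply: vgeB.
  by apply: vgeM0 => //; apply: (vgeW _ (vge_ev_root vy0 vy2 rg)).
have vx1 : vge v (-1) x by rewrite vge_ord ?vx.
exact: vgeW (vgeM (vge_ev_root vy0 vy2 rq) vx1).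
Qed.

Let root_g t : root g t -> t = b.
Proof.
move=> rg; apply/eqP; apply/negPn/negP => tb.
have [dt|dt] := eqVneq (d * t ^+ 2) 1; first by have [_ /negP[]] := infty_q dt.
have e0 : 1 - d * t ^+ 2 != 0 by rewrite subr_eq0 eq_sym.
(* The points of the curve with [y = t] are [(x0, t)] and [(- x0, t)]; [f g(y)] vanishes at both. If
   they coincide, the double zero of [y - t] replaces the second point. *)
have [x0 Ex0] := closed_sqrt ((1 - t ^+ 2) / (1 - d * t ^+ 2)).
have on_t s : s ^+ 2 = x0 ^+ 2 -> on_edwards d (s, t).
  rewrite /on_edwards /= => ->; rewrite Ex0.
  by field.
have reg (v : place i) : vge v 1 (y - i t) -> vge v 0 f.
  move=> vy; apply: f_reg; apply: contra tb => /lies_above_vge[_ vb].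
  by rewrite (vge1_inj vy vb).
have gt (v : place i) n :
    vge v 1 (y - i t) -> vge v n (y - i t) -> vge v n (f * g^y).
  move=> vy vn; apply: vgeM0 (reg v vy) _.
  exact: vge_ev_root (vge_subC vy) vn rg.
have [x00|x00] := eqVneq x0 0.
  have [v [[vx vy] [_ /(_ x00) vx1] _ _]] :=
    edwards_place funF two0 d1 (on_t x0 erefl).
  have t2 : t ^+ 2 = 1.
    move: Ex0; rewrite x00 expr0n => /esym/eqP.
    by rewrite mulf_eq0 invr_eq0 (negbTE e0) orbF subr_eq0 => /eqP.
  rewrite x00 rmorph0 subr0 in vx.
  have [] := axis_q t2 vx1 vy; first by rewrite gt // vge2_axis.
  exact: coprime_pqg.
have [v [[vx vy] _ _ _]] := edwards_place funF two0 d1 (on_t x0 erefl).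
have [w [[wx wy] _ _ _]] := edwards_place funF two0 d1 (on_t _ (sqrrN x0)).
have E1 := eval_at vx vy (gt _ _ vy vy).
have := eval_at wx wy (gt _ _ wy wy); rewrite mulrN => E2.
have [/rootP rp /eqP] := add_sub_eq0 two0 E1 E2.
by rewrite mulf_eq0 (negbTE x00) orbF => /(coprime_pqg rg rp).
Qed.

Let on_opp : on_edwards d (- a, b).
Proof. by move: onP; rewrite /on_edwards /= sqrrN. Qed.

Let axis_b : a = 0 -> b ^+ 2 = 1.
Proof.
move=> a0; move: onP; rewrite /on_edwards /= a0 expr0n /=.
by rewrite mulr0 mul0r addr0 add0r.
Qed.

Let opp_reg (v : place i) : a != 0 -> vge v 1 (x - i (- a)) -> vge v 0 f.
Proof.
move=> a0 vx; apply: f_reg; apply: contra a0 => /lies_above_vge[/= va _].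
have /eqP := vge1_inj vx va; rewrite eq_sym -subr_eq0 opprK -mulr2n -mulr_natl.
by rewrite mulf_eq0 (negbTE two0).
Qed.

(** With a double root at [b], [f g(y)] would vanish at [(a, b)] despite the simple pole, and also
    at [(- a, b)], so [b] would be a common root. If [a = 0], its order is at least [-1 + 4]. *)
Let simple_g g1 : g != g1 * ('X - b%:P) ^+ 2.
Proof.
apply/eqP => Eg; have rg : root g b.
  by rewrite Eg rootM root_exp_XsubC eqxx orbT.
have gb (v : place i) n m :
    vge v 1 (y - i b) -> vge v n (y - i b) -> vge v m f ->
    vge v (m + n *+ 2) (f * g^y).
  move=> vy vn vf; apply: vgeM => //; rewrite Eg evM evXn ev_XsubC.
  apply: vgeM0; first exact: vge_ev (vge_subC vy).
  by rewrite -mulr_natl; exact: (vgeX 2 vn).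
have [v [[vx vy] [_ vx1] _ _]] := edwards_place funF two0 d1 onP.
have [a0|a0] := eqVneq a 0.
  rewrite a0 rmorph0 subr0 in vx.
  have [] := axis_q (axis_b a0) (vx1 a0) vy; last exact: coprime_pqg.
  by apply: vgeW (gb _ _ _ vy (vge2_axis (axis_b a0) vx vy) (f_pole v)).
have [w [[wx wy] _ _ _]] := edwards_place funF two0 d1 on_opp.
have E1 := eval_at vx vy (gb _ _ _ vy vy (f_pole v)).
have E2 : p.[b] - q.[b] * a = 0.
  rewrite -mulrN; apply: (eval_at wx wy).
  by apply: (@vgeW _ _ _ _ _ (0 + 1 *+ 2)); rewrite ?gb ?opp_reg.
have [/rootP rp /eqP] := add_sub_eq0 two0 E1 E2.
by rewrite mulf_eq0 (negbTE a0) orbF => /(coprime_pqg rg rp).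
Qed.

(** The value of [f g(y)] is 0 at [(- a, b)], where [f] is regular, so [p] would vanish at [b] as
    well. If [a = 0], the order of [g(y)] at the point is at least 2 and outweighs the pole. *)
Let root_gb : root g b -> root q b -> False.
Proof.
move=> rg rq; apply: (coprime_pqg rg _ rq).
have gb (v : place i) n m :
    vge v 1 (y - i b) -> vge v n (y - i b) -> vge v m f ->
    vge v (m + n) (f * g^y).
  by move=> vy vn vf; apply: vgeM vf _; exact: vge_ev_root (vge_subC vy) vn rg.
have [a0|a0] := eqVneq a 0.
  have [v [[vx vy] [_ vx1] _ _]] := edwards_place funF two0 d1 onP.
  rewrite a0 rmorph0 subr0 in vx; apply: (axis_p (axis_b a0) vx vy).
  exact: (gb _ 2 _ vy (vge2_axis (axis_b a0) vx vy) (f_pole v)).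
have [w [[wx wy] _ _ _]] := edwards_place funF two0 d1 on_opp.
have := eval_at wx wy (gb _ _ _ wy wy (opp_reg a0 wx)).
by move/rootP: rq => ->; rewrite mul0r addr0 => /rootP.
Qed.

Let size_g : (size g <= 2)%N.
Proof.
have [->//|/closed_rootP[t rt]] := eqVneq (size g) 1%N.
have Et := root_g rt; rewrite {t}Et in rt.
have /factor_theorem[g1 Eg] := rt; rewrite Eg.
have g10 : g1 != 0 by apply: contraNneq g0 => E; rewrite Eg E mul0r.
rewrite size_Mmonic ?monicXsubC // size_XsubC addn2 /= ltnS.
have [->//|/closed_rootP[t rt1]] := eqVneq (size g1) 1%N.
have Et : t = b by apply: root_g; rewrite Eg rootM rt1.
have /factor_theorem[g2 Eg1] := rt1.
by have /eqP[] := simple_g g2; rewrite Eg Eg1 Et expr2 mulrA.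
Qed.

Let infty_size n :
  (size g <= n.+1)%N -> (size p <= n.+1)%N /\ (size q <= n.+1)%N.
Proof.
(* Descent on a common degree bound [N + 1] for [p] and [q], starting from one that surely holds. *)
move=> le_gn; pose N := (size p + size q + n)%N.
have : (n <= N)%N /\ (size p <= N.+1)%N /\ (size q <= N.+1)%N.
  by rewrite /N; lia.
move: N; elim=> [|N IHN] [le_nN [le_p le_q]].
  by have -> : n = 0%N by lia.
have [->|le_nN'] : n = N.+1 \/ (n <= N)%N by lia.
  by [].
apply: IHN; split=> //.
have [t [dt dt' _]] := two_roots.
(* At the place with [y = oo] and [x = s], this is the coefficient of [y ^+ N.+1] in [f g(y)], whose
   order is at least [- n], hence at least [- N]. Using both [s = t] and [s = - t] kills the two
   coefficients. *)
have lead s : d * s ^+ 2 = 1 -> p`_N.+1 + q`_N.+1 * s = 0.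
  move=> ds; have [v [vy vx]] :=
    edwards_place_infty (function_field_swap funF) two0 d0 d1 ds.
  have y0 : y != 0 by apply: (@ord_neq0 _ _ _ v); rewrite vy.
  have vf : vge v 0 f.
    apply: f_reg; apply/negP => /lies_above_vge[_ /vge_subC/(ord_vge y0)].
    by rewrite vy.
  have vx1 : vge v 1 (x - i s) by rewrite vge_ord ?vx.
  have vfg : vge v (- N%:Z) (f * g^y).
    by apply: vgeM0 => //; apply: vgeW (vge_ev_pole vy le_gn); rewrite lerN2 lez_nat.
  have low (r : {poly L}) : vge v (- N%:Z) (\sum_(l < N.+1) i r`_l * y ^+ l).
    rewrite vge_sum // => l _.
    by rewrite vgeM0 ?vge_const // vge_ord // ordX vy mulrN1 lerN2 lez_nat -ltnS.
  have yN0 : y ^+ N.+1 != 0 by rewrite expf_neq0.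
  have vyN : v (y ^+ N.+1) = - N.+1%:Z by rewrite ordX vy mulrN1.
  apply: (@vge1_const _ _ _ v); apply: (vge_cancel yN0).
  have -> : 1 + v (y ^+ N.+1) = - N%:Z.
    by rewrite vyN -add1n PoszD opprD addrA subrr add0r.
  move: vfg; rewrite fE (ev_sum _ _ le_p) (ev_sum _ _ le_q).
  rewrite !(@big_ord_recr _ _ _ N.+1) /=.
  move: (low q) (low p).
  move: (\sum_(_ < _) _) (\sum_(_ < _) _) => P Q vQ vP vfg.
  have -> : i (p`_N.+1 + q`_N.+1 * s) * y ^+ N.+1 =
    (P + i p`_N.+1 * y ^+ N.+1 + (Q + i q`_N.+1 * y ^+ N.+1) * x)
      - (P + Q * x + i q`_N.+1 * (y ^+ N.+1 * (x - i s))).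
    by rewrite rmorphD rmorphM; ring.
  apply: vgeB; first exact: vfg.
  apply: vgeD.
    by apply: vgeD vP _; rewrite mulrC; exact: vgeM0 (vge_subC vx1) vQ.
  rewrite vgeM0 ?vge_const //.
  have -> : - N%:Z = - N.+1%:Z + 1.
    by rewrite -addn1 PoszD opprD addrNK.
  by rewrite vgeM // vge_ord ?vyN.
have E1 := lead _ dt; have := lead _ dt'; rewrite mulrN => E2.
have [p0 /eqP] := add_sub_eq0 two0 E1 E2; rewrite mulf_eq0 orbC.
case: eqP => [t0|_ /= /eqP q0].
  by move/eqP: dt; rewrite t0 expr0n mulr0 eq_sym oner_eq0.
have shrink (r : {poly L}) :
    (size r <= N.+2)%N -> r`_N.+1 = 0 -> (size r <= N.+1)%N.
  move=> le_r r0; apply/leq_sizeP => k.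
  rewrite leq_eqVlt => /orP[/eqP<- //|lt_k].
  by move/leq_sizeP: le_r; apply.
by split; apply: shrink.
Qed.

Lemma representation_constant : exists c, f = i c.
Proof.
have q0 : q = 0.
  apply/eqP; apply/negPn/negP => q0.
  have [t [/infty_q[r1 _] /infty_q[r2 _] tt]] := two_roots.
  (* Two distinct roots are too many for a polynomial of degree at most 1. *)
  have := @max_poly_roots _ q [:: t; - t] q0.
  rewrite /= r1 r2 !inE tt => /(_ isT isT).
  by have [_ le_q] := infty_size size_g; rewrite ltnNge le_q.
have size_g1 : size g = 1%N.
  apply/eqP; apply/negPn/negP => /closed_rootP[t rt].
  have Et := root_g rt; rewrite {t}Et in rt.
  by apply: (root_gb rt); rewrite q0 root0.
have [size_p _] := @infty_size 0 (eq_leq size_g1).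
have Eg := size1_polyC (eq_leq size_g1); have Ep := size1_polyC size_p.
have gc0 : g`_0 != 0 by apply: contraNneq g0 => E; rewrite Eg E.
exists (p`_0 / g`_0).
apply: (@mulIf _ (i g`_0)); first by rewrite fmorph_eq0.
by have := fE; rewrite q0 ev0 mul0r addr0 Eg Ep !evC -rmorphM /= !coefC divfK.
Qed.

End Representation.

Lemma no_simple_pole : exists c, f = i c.
Proof.
have [p [q [g [g0 fE]]]] : exists p q g : {poly L},
    g != 0 /\ f * g^y = p^y + q^y * x.
  have [p [q [g [g0 E]]]] := function_field_gen funF f.
  by exists p, (q * denom d), g; split=> //; rewrite E evM; ring.
(* Lowest terms are reached by cancelling common roots, by induction on the size of [g]. *)
have [n] := ubnP (size g); elim: n p q g g0 fE => // n IHn p q g g0 fE le_gn.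
have [[t [rg rp rq]]|coprime_pqg] :=
  classic (exists t, [/\ root g t, root p t & root q t]); last first.
  apply: (representation_constant g0 fE) => t rg rp rq; apply: coprime_pqg.
  by exists t.
have /factor_theorem[g1 Eg] := rg; have /factor_theorem[p1 Ep] := rp.
have /factor_theorem[q1 Eq] := rq.
have g10 : g1 != 0 by apply: contraNneq g0 => E; rewrite Eg E mul0r.
apply: (IHn p1 q1 g1 g10); last first.
  by move: le_gn; rewrite Eg size_Mmonic ?monicXsubC // size_XsubC addn2.
have yt : y - i t != 0.
  rewrite -ev_XsubC.
  apply: (ev_cover_neq0 (@function_field_free _ _ _ _ _ _ funF)).
  by rewrite polyXsubC_eq0.
apply: (mulIf yt); move: fE; rewrite Eg Ep Eq !evM ev_XsubC mulrA => ->; ring.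
Qed.

End NoSimplePole.

(** * Orders of the functions F_m *)

Section AxisPlaces.

Variables (L F : fieldType) (i : {rmorphism L -> F}) (x y : F) (d : L).
Hypothesis funF : is_function_field i x y (edwards_poly d).
Hypotheses (two0 : 2%:R != 0 :> L) (d1 : d != 1).
Implicit Types (v : place i).

Lemma y_subC_neq0 c : y - i c != 0.
Proof.
rewrite -ev_XsubC.
apply: (ev_cover_neq0 (@function_field_free _ _ _ _ _ _ funF)).
by rewrite polyXsubC_eq0.
Qed.

Lemma sq1_neq0 (t : L) : t ^+ 2 = 1 -> t != 0.
Proof.
by move=> t2; apply: contra_eq_neq t2 => ->; rewrite expr0n eq_sym oner_neq0.
Qed.

Lemma double_neq0 (t : L) : t != 0 -> t + t != 0.
Proof. by move=> t0; rewrite -mulr2n -mulr_natl mulf_neq0. Qed.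

Lemma ord_denom v c : d * c ^+ 2 != 1 -> vge v 1 (y - i c) ->
  1 - i d * y ^+ 2 != 0 /\ v (1 - i d * y ^+ 2) = 0.
Proof.
move=> dc vy; rewrite -(ev_denom i y d); apply: ord_ev_unit vy _.
by rewrite /root horner_denom subr_eq0 eq_sym.
Qed.

Lemma ord_addC v f c e : vge v 1 (f - i c) -> c + e != 0 ->
  f + i e != 0 /\ v (f + i e) = 0.
Proof.
by move=> vf ce; apply: (ord_unit ce); rewrite rmorphD (addrC (i c)) addrKA.
Qed.

(** The curve equation gives [2 v(x) = v(y - t)], because [1 - d y^2] and [y + t] are units. So [x]
    vanishes, and [v] is the unique place above [(0, t)], where [x] has order 1. *)
Lemma axis_place v t : t ^+ 2 = 1 -> vge v 1 (y - i t) ->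
  v x = 1 /\ v (y - i t) = 2.
Proof.
move=> t2 vy; have t0 := sq1_neq0 t2.
have [den0 vden] : 1 - i d * y ^+ 2 != 0 /\ v (1 - i d * y ^+ 2) = 0.
  by apply: ord_denom vy; rewrite t2 mulr1.
have [yt0 vyt] := ord_addC vy (double_neq0 t0).
have yn0 := y_subC_neq0 t.
have E : x ^+ 2 * (1 - i d * y ^+ 2) = i (-1) * (y - i t) * (y + i t).
  by rewrite -mulrA -subr_sqr -rmorphXn t2 rmorphN rmorph1 (edwards_sq funF); ring.
have x0 : x != 0.
  apply: contraTneq yn0 => x0; rewrite negbK.
  move/esym/eqP: E; rewrite x0 expr0n mul0r !mulf_eq0 fmorph_eq0 oppr_eq0.
  by rewrite oner_eq0 (negbTE yt0) orbF.
have v2 : v x *+ 2 = v (y - i t).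
  have := congr1 v E.
  rewrite !ordM ?mulf_neq0 ?expf_neq0 ?fmorph_eq0 ?oppr_eq0 ?oner_neq0 //.
  by rewrite ordC vden vyt; lia.
have vx1 : vge v 1 x.
  by apply: vge_ord; have := ord_vge yn0 vy; rewrite -v2; lia.
have on_t : on_edwards d (0, t) by rewrite /on_edwards /= expr0n /= t2; ring.
have [w [_ [_ /(_ erefl) wx] _ uniq]] := edwards_place funF two0 d1 on_t.
have vw : v =1 w by apply: uniq; rewrite // rmorph0 subr0.
by rewrite -v2 vw wx.
Qed.

Lemma axis_lies_above v t : t ^+ 2 = 1 ->
  vge v 1 (y - i t) -> lies_above x y (0, t) v.
Proof.
move=> t2 /(axis_place t2)[vx vy].
by rewrite /lies_above rmorph0 subr0 vx vy.
Qed.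

End AxisPlaces.

Lemma sqrrN1 (R : pzRingType) : (-1) ^+ 2 = 1 :> R.
Proof. by rewrite sqrrN expr1n. Qed.

(** * The zeros of [x] *)

Section AxisPoints.

Variables (L F : fieldType) (i : {rmorphism L -> F}) (x y : F) (d : L).
Hypothesis funF : is_function_field i x y (edwards_poly d).
Implicit Types (v : place i) (f : F).
Local Notation funF' := (function_field_swap funF).

(** From [(y^2 - 1) (1 - d x^2) = (d - 1) x^2], the product [(y - 1) (y + 1)] has positive order,
    hence so has one factor. *)
Lemma axis_y v : 0 < v x -> exists2 t, t ^+ 2 = 1 & vge v 1 (y - i t).
Proof.
move=> vx; have vx0 : vge v 1 (x - i 0) by rewrite rmorph0 subr0 vge_ord.
have [den0 vden] : 1 - i d * x ^+ 2 != 0 /\ v (1 - i d * x ^+ 2) = 0.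
  by apply: ord_denom vx0; rewrite expr0n mulr0 eq_sym oner_neq0.
have vx1 : vge v 1 x by rewrite vge_ord.
have vx2 : vge v 1 (x ^+ 2) by have := vgeX 2 vx1; exact: vgeW.
have vy2 : vge v 1 (y ^+ 2 - i 1).
  apply: (vge_cancel den0); rewrite vden addr0 mulrBl (edwards_sq funF') rmorph1.
  have -> : 1 - x ^+ 2 - 1 * (1 - i d * x ^+ 2) = i (d - 1) * x ^+ 2.
    by rewrite rmorphB rmorph1; ring.
  by rewrite vgeM0 ?vge_const.
have yn1 := y_subC_neq0 funF 1; have yn2 := y_subC_neq0 funF (-1).
have E : y ^+ 2 - i 1 = (y - i 1) * (y - i (-1)).
  by rewrite rmorphN rmorph1; ring.
rewrite E in vy2; have := ord_vge (mulf_neq0 yn1 yn2) vy2.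
rewrite ordM // => v12.
have [le_v1|lt_v1] := leP 1 (v (y - i 1)).
  by exists 1; rewrite ?expr1n // vge_ord.
by exists (-1); rewrite ?sqrrN1 // vge_ord //; lia.
Qed.

End AxisPoints.

(** * Poles of the Edwards functions *)

Section EdwardsFunctions.

Variables (L F : fieldType) (i : {rmorphism L -> F}) (x y : F) (d : L).
Hypothesis funF : is_function_field i x y (edwards_poly d).
Hypotheses (two0 : 2%:R != 0 :> L) (d1 : d != 1).
Implicit Types (v : place i) (f : F).
Local Notation funF' := (function_field_swap funF).

Lemma not_above_O v : ~~ lies_above x y (0, 1) v -> vge v 0 (y - 1)^-1.
Proof.
move=> nO; apply: vgeV; rewrite leNgt; apply: contra nO => vy.
by apply: (axis_lies_above funF two0 d1); rewrite ?expr1n // rmorph1 vge_ord.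
Qed.

Lemma above_O v : lies_above x y (0, 1) v ->
  [/\ v x = 1, v (y - 1) = 2, vge v 1 (x - i 0) & vge v 1 (y - i 1)].
Proof.
move=> /lies_above_vge[/= vx vy].
have [vx1 vy2] := axis_place funF two0 d1 (expr1n _ _) vy.
by split; rewrite // -(rmorph1 i).
Qed.

Let x0 : x != 0.
Proof. by have := y_subC_neq0 funF' 0; rewrite rmorph0 subr0. Qed.
Let y0 : y != 0.
Proof. by have := y_subC_neq0 funF 0; rewrite rmorph0 subr0. Qed.
Let ym1 : y - 1 != 0.
Proof. by have := y_subC_neq0 funF 1; rewrite rmorph1. Qed.
Let yp1 : y + 1 != 0.
Proof. by have := y_subC_neq0 funF (-1); rewrite rmorphN rmorph1 opprK. Qed.

(** The formula of [edwards_F] for [m] at least 2, where it does not depend on the point [P]. *)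
Definition tail_function (m : nat) : F :=
  if odd m then (y + 1) / (x * (y - 1) ^+ m./2) else 1 / (y - 1) ^+ m./2.

Lemma tail_function_O v m : lies_above x y (0, 1) v ->
  v (tail_function m) = - m%:Z.
Proof.
move=> /above_O[vx vy _ vy1].
have [_] := ord_addC vy1 (double_neq0 two0 (oner_neq0 L)).
rewrite rmorph1 => vyp.
have := odd_double_half m; rewrite /tail_function -mul2n.
case: (odd m) => Em.
  rewrite ordM ?invr_eq0 ?mulf_neq0 ?expf_neq0 // ordV ordM ?expf_neq0 //.
  by rewrite ordX vx vy vyp; lia.
by rewrite div1r ordV ordX vy; lia.
Qed.

Lemma tail_function_reg v m : (1 < m)%N -> ~~ lies_above x y (0, 1) v ->
  vge v 0 (tail_function m).
Proof.
move=> m1 nO; have vu := not_above_O nO.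
rewrite /tail_function; case: ifP => _; last by rewrite div1r -exprVn vgeX0.
(* One factor [y - 1] is set aside, which [1 < m] allows, leaving [(y + 1) / ((y - 1) x)] to be
   treated. Off O it could only have a pole at [(0, -1)], where [y + 1] has order 2 and [x] order
   1. *)
have -> : m./2 = (m./2).-1.+1 by rewrite prednK // half_gt0.
have -> : (y + 1) / (x * (y - 1) ^+ (m./2).-1.+1) =
    (y - 1)^-1 ^+ (m./2).-1 * ((y + 1) * (y - 1)^-1 * x^-1).
  rewrite exprS exprVn; have := expf_neq0 (m./2).-1 ym1 => h.
  by field; rewrite x0 ym1.
apply: vgeM0; first exact: vgeX0.
have [vx|vx] := leP (v x) 0.
  apply: vgeM0 (vgeV vx).
  have -> : (y + 1) * (y - 1)^-1 = 1 + i 2%:R * (y - 1)^-1.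
    by rewrite rmorph_nat; field.
  by rewrite vgeD ?vge1 // vgeM0 ?vge_const.
have [t t2 vy] := axis_y funF vx.
have [vx1 vyt] := axis_place funF two0 d1 t2 vy.
have yn0 := y_subC_neq0 funF t.
have [t1|t1] := eqVneq t 1.
  by have := axis_lies_above funF two0 d1 t2 vy; rewrite t1 (negbTE nO).
have tN : t = -1.
  by move/eqP: t2; rewrite sqrf_eq1 (negbTE t1) => /eqP.
rewrite tN rmorphN rmorph1 opprK in vyt.
apply: vge_ord; rewrite !ordM ?mulf_neq0 ?invr_eq0 // ordV ordV vx1 vyt.
have : v (y - 1) <= 0; last by move: (v (y - 1)) => n; clear; lia.
rewrite -oppr_ge0 -ordV; apply: ord_vge vu; by rewrite invr_eq0.
Qed.

(** The property required of [F_1]: the order at O must be exact for the reduction and the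
    independence, while at [p] a bound on the pole suffices. *)
Definition simple_O_P (p : L * L) f : Prop := forall v,
  [/\ lies_above x y (0, 1) v -> v f = -1,
      lies_above x y p v -> vge v (-1) f &
      ~~ lies_above x y (0, 1) v -> ~~ lies_above x y p v -> vge v 0 f].

Lemma simple_O' : simple_O_P (0, -1) (1 / x).
Proof.
move=> v; rewrite div1r.
split=> [/above_O[vx _ _ _]|/lies_above_vge[_ vy]|nO nO'].
- by rewrite ordV vx.
- rewrite vge_ord // ordV.
  by have [-> _] := axis_place funF two0 d1 (sqrrN1 _) vy.
apply: vgeV; rewrite leNgt; apply/negP => /(axis_y funF)[t t2 vy].
have := axis_lies_above funF two0 d1 t2 vy.
move/eqP: t2; rewrite sqrf_eq1 => /orP[] /eqP->; exact/negP.
Qed.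

(** The signs [s = 1] and [s = -1] give H and H'. The factor [y + 1] cancels the zero of [x] at
    [(0, -1)], and [x + s] cancels the zero of [y] at [(- s, 0)], so only O and [(s, 0)] remain. *)
Lemma simple_H s : s ^+ 2 = 1 ->
  simple_O_P (s, 0) ((x + i s) * (y + 1) / (x * y)).
Proof.
move=> s2 v; have s0 := sq1_neq0 s2.
have E : (x + i s) * (y + 1) / (x * y) = (x + i s) * (y + 1) * x^-1 * y^-1.
  by field; rewrite x0 y0.
have xs0 : x + i s != 0.
  by have := y_subC_neq0 funF' (- s); rewrite rmorphN opprK.
rewrite {}E; split=> [/above_O[vx vy vx1 vy1]|/lies_above_vge[/= vx vy]|nO nH].
- have s0' : 0 + s != 0 by rewrite add0r.
  have [_ vxs] := ord_addC vx1 s0'.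
  have [_ vyp] := ord_addC vy1 (double_neq0 two0 (oner_neq0 L)).
  have l0' : 1 + 0 != 0 :> L by rewrite addr0 oner_neq0.
  have [_ vy0] := ord_addC vy1 l0'.
  rewrite rmorph0 addr0 in vy0; rewrite rmorph1 in vyp.
  by rewrite !ordM ?mulf_neq0 ?invr_eq0 // !ordV vxs vyp vx vy0.
- have [vy1 _] := axis_place funF' two0 d1 s2 vx.
  have s0' : s + 0 != 0 by rewrite addr0.
  have [_ vx0] := ord_addC vx s0'.
  rewrite rmorph0 addr0 in vx0.
  rewrite -[-1]add0r; apply: vgeM; last by rewrite vge_ord // ordV vy1.
  rewrite vgeM0 //; last by rewrite vgeV ?vx0.
  rewrite vgeM0 // vgeD ?vge_const ?vge1 ?(vge_subC vy) ?(vge_subC vx) //.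
have [vx|vx] := leP (v x) 0; last first.
  have [t t2 vy] := axis_y funF vx.
  have [vx1 vyt] := axis_place funF two0 d1 t2 vy.
  have yn0 := y_subC_neq0 funF t.
  have := axis_lies_above funF two0 d1 t2 vy.
  have [->|t1] := eqVneq t 1; first by rewrite (negbTE nO).
  have tN : t = -1 by move/eqP: t2; rewrite sqrf_eq1 (negbTE t1) => /eqP.
  have t0' : t + 0 != 0 by rewrite addr0 (sq1_neq0 t2).
  have [_ vy0] := ord_addC vy t0'.
  rewrite rmorph0 addr0 in vy0.
  rewrite tN rmorphN rmorph1 opprK in vyt => _.
  apply: vgeM0; last by rewrite vgeV ?vy0.
  have -> : (x + i s) * (y + 1) / x = (x + i s) * ((y + 1) / x).
    by rewrite mulrA.
  apply: vgeM0; first by rewrite vgeD ?vge_const // vge_ord ?vx1.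
  by apply: vge_ord; rewrite ordM ?invr_eq0 // ordV vyt vx1.
have [vy|vy] := leP (v y) 0.
  (* In terms of [1 / x] and [1 / y] regularity is visible even where [x] or [y] has a pole. *)
  have -> : (x + i s) * (y + 1) / x / y = (1 + i s * x^-1) * (1 + y^-1).
    by field; rewrite x0 y0.
  by rewrite vgeM0 // vgeD ?vge1 ?vgeM0 ?vge_const // vgeV.
have vy1 : vge v 1 (y - i 0) by rewrite rmorph0 subr0 vge_ord.
have [t t2 vx1] := axis_y funF' vy.
have [yy1 vxt] := axis_place funF' two0 d1 t2 vx1.
have /eqP : t ^+ 2 = s ^+ 2 by rewrite t2 s2.
rewrite eqf_sqr => /orP[] /eqP ts; last first.
  rewrite ts rmorphN opprK in vx1 vxt.
  have -> : (x + i s) * (y + 1) / x / y = (x + i s) / y * ((y + 1) / x).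
    by field; rewrite x0 y0.
  apply: vgeM0; first by apply: vge_ord; rewrite ordM ?invr_eq0 // ordV vxt yy1.
  apply: vgeM0; first by rewrite vgeD ?vge1 // vge_ord ?yy1.
  exact: vgeV vx.
case/negP: nH; have := axis_lies_above funF' two0 d1 t2 vx1.
by rewrite ts /lies_above /= andbC.
Qed.

Lemma simple_generic a b : on_edwards d (a, b) -> a != 0 -> b != 0 ->
  simple_O_P (a, b) ((y + i b) * x / ((x - i a) * (y - 1))).
Proof.
move=> onP a0 b0 v; have E2 := on_edwards_sq onP.
have da : d * a ^+ 2 != 1 by exact: (on_edwards_denom d1 (on_edwards_swap onP)).
have da0 : i (d * a ^+ 2 - 1) != 0 by rewrite fmorph_eq0 subr_eq0.
have b1 : b ^+ 2 != 1.
  apply: contra a0 => /eqP b1; move: E2; rewrite b1 mulr1 subrr => /eqP.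
  by rewrite mulf_eq0 subr_eq0 (eq_sym 1) (negbTE d1) orbF expf_eq0.
have bp1 : 1 + b != 0.
  by apply: contra b1; rewrite addrC addr_eq0 => /eqP->; rewrite sqrrN expr1n.
have bm1 : b + (-1) != 0.
  by apply: contra b1; rewrite subr_eq0 => /eqP->; rewrite expr1n.
have xa0 := y_subC_neq0 funF' a; have yb0 := y_subC_neq0 funF b.
have yb0' : y + i b != 0.
  by have := y_subC_neq0 funF (- b); rewrite rmorphN opprK.
(* Subtracting the equations of [(x, y)] and [(a, b)] gives [(x - a) c = (y - b) (y + b)]. So
   [y + b] cancels the zero of [x - a] at [(a, - b)], and the function becomes
   [c x / ((y - 1) (y - b))]. *)
pose c := (x + i a) * (1 - i d * y ^+ 2) / i (d * a ^+ 2 - 1).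
have cE : (x - i a) * c = (y - i b) * (y + i b).
  rewrite /c; apply: (mulIf da0); rewrite mulrA divfK //.
  have E1 := edwards_sq funF; have E2' := congr1 i E2.
  rewrite !(rmorphM, rmorphB, rmorph1, rmorphXn) /= in E2' *.
  transitivity (x ^+ 2 * (1 - i d * y ^+ 2) - i a ^+ 2 * (1 - i d * i b ^+ 2)
    + i a ^+ 2 * i d * (y ^+ 2 - i b ^+ 2)); first by ring.
  by rewrite E1 E2'; ring.
have fE : (y + i b) * x / ((x - i a) * (y - 1)) =
    c * x * (y - 1)^-1 * (y - i b)^-1.
  have -> : y + i b = (x - i a) * c / (y - i b).
    by rewrite cE mulrAC mulfV ?mul1r.
  by field; rewrite ym1 yb0 xa0.
have vc : vge v 0 x -> vge v 0 y -> vge v 0 c.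
  move=> vx vy; rewrite /c -fmorphV mulrC vgeM0 ?vge_const // vgeM0 //.
    by rewrite vgeD ?vge_const.
  by rewrite vgeB ?vge1 // vgeM0 ?vgeX0 ?vge_const.
split=> [/above_O[vx vy vx1 vy1]|/lies_above_vge[/= vx vy]|nO nP].
- have na0 : 0 + - a != 0 by rewrite add0r oppr_eq0.
  have [_ vxa] := ord_addC vx1 na0.
  rewrite rmorphN in vxa; have [_ vyb] := ord_addC vy1 bp1.
  by rewrite !ordM ?invr_eq0 ?mulf_neq0 // ordV ordM // vxa vyb vx vy.
- have [w [_ [/(_ a0) wy _] _ uniq]] := edwards_place funF two0 d1 onP.
  have [_] := ord_addC vy bm1; rewrite rmorphN rmorph1 => vym.
  rewrite fE -[-1]add0r; apply: vgeM; last first.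
    by rewrite vge_ord // ordV (uniq v vx vy) wy.
  apply: vgeM0; last by rewrite vgeV ?vym.
  by rewrite vgeM0 ?vc ?(vge_subC vx) ?(vge_subC vy).
have vu := not_above_O nO.
have [vx|vx] := leP (v (x - i a)) 0.
  (* Where [x - a] does not vanish, this form is regular even at the poles of [x] and [y]. *)
  have -> : (y + i b) * x / ((x - i a) * (y - 1)) =
     (1 + i (1 + b) * (y - 1)^-1) * (1 + i a * (x - i a)^-1).
    by rewrite rmorphD rmorph1; field; rewrite xa0 ym1.
  by rewrite vgeM0 // vgeD ?vge1 ?vgeM0 ?vge_const // vgeV.
have vx1 : vge v 1 (x - i a) by rewrite vge_ord.
have vx0 := vge_subC vx1.
(* Since [1 - d a^2] is nonzero, [y^2 (1 - d x^2) = 1 - x^2] bounds [y] where [x = a]. *)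
have vy : vge v 0 y.
  rewrite vge_ord //; have [den0 vden] := ord_denom da vx1.
  have /(ord_vge _) : vge v 0 (y ^+ 2).
    apply: (vge_cancel den0); rewrite vden (edwards_sq funF').
    by rewrite vgeB ?vge1 ?vgeX0.
  by rewrite expf_neq0 // ordX pmulr_rge0 // => ->.
rewrite fE; apply: vgeM0; last first.
  rewrite vgeV // leNgt; apply: contra nP => vyb.
  by rewrite /lies_above vx.
by rewrite vgeM0 // vgeM0 ?vc.
Qed.

End EdwardsFunctions.

(** * Bases of the spaces L(D_n) *)

Section Filtration.

Variables (L F : fieldType) (i : {rmorphism L -> F}).
(** Places are compared through their order functions, so the added point is a predicate [above]
    whose members all agree with [v0] pointwise. *)
Variables (D : nat -> divisor i) (above : pred (place i)) (v0 : place i).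
Variable G : nat -> F.
Hypothesis D_ge0 : forall v, 0 <= D 0 v.
Hypothesis DS : forall n v, D n.+1 v = D n v + (above v)%:Z.
Hypothesis above_v0 : forall v, above v -> v =1 v0.
Hypothesis v0_above : above v0.
Hypothesis v0_residue : forall f, vge v0 0 f -> exists c, vge v0 1 (f - i c).
Hypothesis D0_const :
  forall f, (forall v, vge v (- D 0 v) f) -> exists c, f = i c.
Hypothesis G0 : G 0 = 1.
Hypothesis G_reg : forall n v, vge v (- D n.+1 v) (G n.+1).
Hypothesis G_ord : forall n v, above v -> v (G n.+1) = - D n.+1 v.

Let D_mono m n v : (m <= n)%N -> D m v <= D n v.
Proof.
elim: n => [|n IHn]; first by rewrite leqn0 => /eqP->.
rewrite leq_eqVlt => /orP[/eqP-> //|]; rewrite ltnS => /IHn.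
by rewrite DS; case: (above v) => /=; lia.
Qed.

Let G_neq0 n : G n.+1 != 0.
Proof.
apply: (@ord_neq0 _ _ _ v0); rewrite G_ord // DS v0_above oppr_eq0.
by have := le_trans (D_ge0 v0) (D_mono v0 (leq0n n)); lia.
Qed.

Lemma vge_comb n (c : nat -> L) v :
  vge v (- D n v) (\sum_(m < n.+1) i (c m) * G m).
Proof.
rewrite vge_sum // => -[m lt_m] _ /=; rewrite vgeM0 ?vge_const //.
case: m lt_m => [|m] lt_m; last first.
  by apply: vgeW (G_reg m v); rewrite lerN2 D_mono.
rewrite G0; apply: vgeW (vge1 v).
by rewrite oppr_le0 (le_trans (D_ge0 v)) ?D_mono.
Qed.

Lemma filtration_span n f : (forall v, vge v (- D n v) f) <->
  exists c : nat -> L, f = \sum_(m < n.+1) i (c m) * G m.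
Proof.
split=> [|[c ->] v]; last exact: vge_comb.
elim: n f => [f /D0_const[c ->]|n IHn f vf].
  by exists (fun=> c); rewrite big_ord1 G0 mulr1.
(* Subtracting [c] times [G n.+1], with [c] the residue of the quotient, gains one order at [v0] and
   leads back to [D n]. *)
have [c vc] : exists c, vge v0 1 (f / G n.+1 - i c).
  apply: v0_residue; apply: (vge_cancel (G_neq0 n)).
  by rewrite divfK // G_ord // add0r vf.
have [v|e Ee] := IHn (f - i c * G n.+1).
  have [va|/negbTE va] := boolP (above v); last first.
    have -> : - D n v = - D n.+1 v by rewrite DS va addr0.
    by rewrite vgeB ?vf // vgeM0 ?vge_const.
  have -> : f - i c * G n.+1 = (f / G n.+1 - i c) * G n.+1.
    by rewrite mulrBl divfK.
  have -> : - D n v = 1 - D n.+1 v by rewrite DS va /=; lia.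
  apply: vgeM; last by rewrite vge_ord ?G_ord.
  by rewrite /vge above_v0.
exists (fun m => if m == n.+1 then c else e m).
rewrite big_ord_recr /= eqxx -[LHS](subrK (i c * G n.+1)) Ee; congr (_ + _).
by apply: eq_bigr => m _; rewrite ltn_eqF.
Qed.

Lemma filtration_free n (c : nat -> L) :
  \sum_(m < n.+1) i (c m) * G m = 0 -> forall m, (m < n.+1)%N -> c m = 0.
Proof.
elim: n => [|n IHn].
  rewrite big_ord1 G0 mulr1 => /eqP; rewrite fmorph_eq0 => /eqP c0.
  by case.
rewrite big_ord_recr /= => E.
have cn : c n.+1 = 0.
  (* Otherwise [G n.+1] would be a combination of the earlier functions, whose order at [v0] is at
     least [- D n v0], one more than its own. *)
  apply/eqP; apply/negPn/negP => cn.
  have icn : i (c n.+1) != 0 by rewrite fmorph_eq0.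
  have : vge v0 (- D n v0) (- (i (c n.+1) * G n.+1)).
    by rewrite -(addr0_eq E) opprK vge_comb.
  move=> /vgeN; rewrite opprK => /(ord_vge (mulf_neq0 icn (G_neq0 n))).
  by rewrite ordM // ordC G_ord // DS v0_above /=; lia.
move: E; rewrite cn rmorph0 mul0r addr0 => /IHn H m.
by rewrite ltnS leq_eqVlt => /orP[/eqP->|/H].
Qed.

End Filtration.

(** * Passage from orders to Riemann-Roch spaces and spans of lists *)

Lemma riemann_roch_vge (L F : fieldType) (i : {rmorphism L -> F})
    (D : divisor i) (f : F) :
  riemann_roch_space D f <-> forall v, vge v (- D v) f.
Proof.
split=> [[[f0 eff] v|-> v]|vf]; last 2 first.
- exact: vge0.
- have [f0|f0] := eqVneq f 0; [by right | left; split=> // v].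
  by rewrite -[D v]opprK subr_ge0 ord_vge.
by apply: vge_ord; have := eff v; rewrite /div_of; lia.
Qed.

Lemma lin_comb_mkseq (L F : fieldType) (i : {rmorphism L -> F}) (G : nat -> F) n
    (c : nat -> L) :
  lin_comb i (fun m : 'I_(size (mkseq G n)) => c m) =
  \sum_(m < n) i (c m) * G m.
Proof.
rewrite /lin_comb size_mkseq; apply: eq_bigr => m _.
by rewrite nth_mkseq.
Qed.

Lemma extend_ord (T : Type) n (c : 'I_n -> T) (t : T) :
  exists e : nat -> T, forall m : 'I_n, c m = e m.
Proof.
exists (fun m => if insub m is Some k then c k else t) => m.
by rewrite valK.
Qed.

Lemma lin_span_mkseq (L F : fieldType) (i : {rmorphism L -> F})
    (G : nat -> F) n f :
  lin_span i (mkseq G n) f <->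
  exists c : nat -> L, f = \sum_(m < n) i (c m) * G m.
Proof.
split=> [[c ->]|[c ->]]; last by exists (fun m => c m); rewrite lin_comb_mkseq.
have [e Ee] := extend_ord c 0; exists e; rewrite -lin_comb_mkseq.
by apply: eq_bigr => m _; rewrite Ee.
Qed.

Lemma lin_independent_mkseq (L F : fieldType) (i : {rmorphism L -> F})
    (G : nat -> F) n :
  (forall c : nat -> L, \sum_(m < n) i (c m) * G m = 0 ->
     forall m, (m < n)%N -> c m = 0) ->
  lin_independent i (mkseq G n).
Proof.
move=> free c; have [e Ee] := extend_ord c 0 => E m.
rewrite Ee; apply: free; last first.
  by apply: leq_trans (ltn_ord m) _; rewrite size_mkseq.
by rewrite -lin_comb_mkseq -E; apply: eq_bigr => l _; rewrite Ee.
Qed.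

(** Both lists become initial segments of one sequence, as the filtration requires; for [P = O] the
    index 1 is skipped. *)
Lemma edwards_list (T : Type) (f : nat -> T) (b : bool) k :
  (if b then f 0 :: [seq f m | m <- seq.iota 2 k]
   else [seq f m | m <- seq.iota 0 k.+1]) =
  mkseq (fun n => if b && (0 < n)%N then f n.+1 else f n) k.+1.
Proof.
case: b => //=; rewrite /mkseq /=; congr (_ :: _).
rewrite (iotaDl 1 1) -map_comp; apply/eq_in_map => m.
by rewrite mem_iota => /andP[m1 _] /=; rewrite m1.
Qed.

(** The points with a zero coordinate are exactly O, O', H and H', so the last case of [edwards_F1]
    has both coordinates nonzero. *)
Lemma simple_F1 (K L F : fieldType) (d : K) (j : {rmorphism K -> L})
    (i : {rmorphism L -> F}) (x y : F) (P : K * K) :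
  is_function_field i x y (edwards_poly (j d)) ->
  2%:R != 0 :> L -> j d != 1 -> on_edwards d P -> P != (0, 1) ->
  simple_O_P i x y (j P.1, j P.2) (edwards_F1 (fun c => i (j c)) x y P).
Proof.
move=> funF two0 d1 onP nO; rewrite /edwards_F1.
case: eqP => [->|/eqP nO'] /=.
  rewrite rmorphN rmorph0 rmorph1; exact: simple_O' funF two0 d1.
case: eqP => [->|/eqP nH] /=.
  have := simple_H funF two0 d1 (expr1n _ 2).
  by rewrite rmorph0 !rmorph1.
case: eqP => [->|/eqP nH'] /=.
  have := simple_H funF two0 d1 (sqrrN1 _).
  by rewrite rmorph0 !rmorphN !rmorph1.
case: P onP nO nO' nH nH' => a b onP; rewrite !xpair_eqE /= => nO nO' nH nH'.
have E : a ^+ 2 + b ^+ 2 = 1 + d * a ^+ 2 * b ^+ 2 by [].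
apply: (simple_generic funF two0 d1); rewrite ?fmorph_eq0.
- by rewrite /on_edwards /= -!rmorphXn -!rmorphM -(rmorph1 j) -!rmorphD E.
- apply: contraNneq nO' => a0; move: E nO; rewrite a0 eqxx expr0n /=.
  rewrite mulr0 mul0r addr0 add0r => /eqP; rewrite sqrf_eq1.
  by case: (b == 1).
- apply: contraNneq nH => b0; move: E nH'; rewrite b0 eqxx expr0n /= !andbT.
  rewrite mulr0 !addr0 => /eqP; rewrite sqrf_eq1.
  by case: (a == -1); rewrite ?orbF.
Qed.

Theorem theorem3p1
  (K : fieldType) (charK : 2%N \notin [pchar K])
  (d : K) (d_nonsquare : ~ exists c : K, d = c ^+ 2)
  (L : closedFieldType) (j : {rmorphism K -> L}) (closureL : algebraic_closure j)
  (F : fieldType) (i : {rmorphism L -> F}) (x y : F)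
  (funF : is_function_field i x y (edwards_poly (j d)))
  (k : nat) (P : K * K) (onP : on_edwards d P) :
  let O : K * K := (0, 1) in
  let pt (Q : K * K) : divisor i := point_divisor x y (j Q.1, j Q.2) in
  let D : divisor i := fun v => pt P v + k%:Z * pt O v in
  let Fn : nat -> F := edwards_F (fun c : K => i (j c)) x y P in
  has_dimension i (riemann_roch_space D) k.+1 /\
  (forall f : F, riemann_roch_space D f <->
     lin_span i (if P == O then Fn 0%N :: [seq Fn m | m <- seq.iota 2 k]
                 else [seq Fn m | m <- seq.iota 0 k.+1]) f).
Proof.
move=> O pt D Fn; rewrite edwards_list; set G := fun n => _.
have two0 : 2%:R != 0 :> L.
  rewrite -(rmorph_nat j) fmorph_eq0; apply: contra charK => two0.
  by rewrite inE.
(* As 0 and 1 are squares in [K], [d] is neither, and this is preserved by [j]. *)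
have d0 : j d != 0.
  rewrite fmorph_eq0; apply/eqP => d0.
  by apply: d_nonsquare; exists 0; rewrite d0 expr0n.
have d1 : j d != 1.
  rewrite fmorph_eq1; apply/eqP => d1.
  by apply: d_nonsquare; exists 1; rewrite d1 expr1n.
have onP' : on_edwards (j d) (j P.1, j P.2).
  move: onP; rewrite /on_edwards /= => E.
  by rewrite -!rmorphXn -!rmorphM -(rmorph1 j) -!rmorphD E.
have onO : on_edwards (j d) (0, 1).
  by rewrite /on_edwards /= expr0n expr1n mulr0 mul0r addr0 add0r.
have [v0 [[v0x v0y] _ res uniq]] := edwards_place funF two0 d1 onO.
pose Dn n : divisor i := fun v => pt P v + n%:Z * pt O v.
pose above : pred (place i) := lies_above x y (0, 1).
have ptO v : pt O v = (above v)%:Z.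
  by rewrite /pt /point_divisor /above /= rmorph0 rmorph1; case: ifP.
have ptP v : pt P v = (lies_above x y (j P.1, j P.2) v)%:Z.
  by rewrite /pt /point_divisor; case: ifP.
have v0_above : above v0.
  by apply: (axis_lies_above funF two0 d1 _ v0y); exact: expr1n.
have above_v0 v : above v -> v =1 v0 by move=> /lies_above_vge[]; exact: uniq.
have FnE n : Fn n.+2 = tail_function x y n.+2 by [].
have aP v : P != O -> above v -> ~~ lies_above x y (j P.1, j P.2) v.
  move=> PO /lies_above_vge[/= ox oy].
  apply: contra PO => /lies_above_vge[/= vx vy].
  have /eqP := vge1_inj vx ox; have /eqP := vge1_inj vy oy.
  rewrite fmorph_eq1 fmorph_eq0 => E1 E2.
  by rewrite -pair_eqE /pair_eq /= E1 E2.
have D_ge0 v : 0 <= Dn 0 v by rewrite /Dn ptP mul0r addr0.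
have DS n v : Dn n.+1 v = Dn n v + (above v)%:Z.
  by rewrite /Dn ptO -addn1 PoszD mulrDl mul1r addrA.
have D0_const f : (forall v, vge v (- Dn 0 v) f) -> exists c, f = i c.
  rewrite /Dn => vf; apply: (no_simple_pole funF two0 d0 d1 onP') => v.
    by move=> /negbTE nv; have := vf v; rewrite ptP nv mul0r.
  apply: vgeW (vf v); rewrite mul0r addr0 ptP lerN2.
  by case: (lies_above _ _ _ _).
have G_cases n v :
    vge v (- Dn n.+1 v) (G n.+1) /\ (above v -> v (G n.+1) = - Dn n.+1 v).
  have tail m : (1 < m)%N -> m%:Z * (above v)%:Z <= Dn n.+1 v ->
      (above v -> Dn n.+1 v = m%:Z) -> vge v (- Dn n.+1 v) (Fn m) /\
      (above v -> v (Fn m) = - Dn n.+1 v).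
    case: m => [|[|m]] // _; rewrite FnE.
    case: (boolP (above v)) => [va|nv] D1 D2.
      have vF := tail_function_O funF two0 d1 m.+2 va.
      by rewrite D2 // vF vge_ord ?vF.
    split=> //; apply: vgeW (tail_function_reg funF two0 d1 _ nv) => //.
    by move: D1; rewrite mulr0 oppr_le0.
  (* If [P = O], then [Dn n.+1] is [(n + 2) O] and [G n.+1] is [F_{n+2}]. Otherwise it is
     [P + (n + 1) O], with [F_{n+1}], and [F_1] is treated apart. *)
  rewrite /G; case: (eqVneq P O) => [PO|PO] /=.
    apply: tail => // [|va]; rewrite /Dn PO ptO; last by rewrite va !mulr1.
    by rewrite -[X in X + _]mul1r -mulrDl.
  case: n tail => [|n] tail; last first.
    apply: tail => // [|va]; rewrite /Dn ptO ptP; last first.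
      by rewrite va (negbTE (aP v PO va)) add0r mulr1.
    by rewrite lerDr; case: lies_above.
  have [vO vP vreg] := simple_F1 funF two0 d1 onP PO v.
  rewrite /Dn ptO ptP; split=> [|va]; last first.
    by rewrite -/(Fn 1%N) vO // va (negbTE (aP v PO va)).
  have [va|nv] := boolP (above v).
    by apply: vge_ord; rewrite vO // (negbTE (aP v PO va)).
  have [vP1|nv1] := boolP (lies_above x y (j P.1, j P.2) v).
    by apply: vgeW (vP vP1).
  by apply: vgeW (vreg nv nv1).
have G_reg n v : vge v (- Dn n.+1 v) (G n.+1) by have [] := G_cases n v.
have G_ord n v : above v -> v (G n.+1) = - Dn n.+1 v by have [_] := G_cases n v.
have G0 : G 0 = 1 by rewrite /G andbF.
have span f : riemann_roch_space D f <-> lin_span i (mkseq G k.+1) f.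
  rewrite riemann_roch_vge lin_span_mkseq.
  exact: (filtration_span D_ge0 DS above_v0 v0_above res D0_const G0 G_reg
    G_ord k f).
split=> //; exists (mkseq G k.+1); split=> //; first exact: size_mkseq.
apply: lin_independent_mkseq => c.
exact: (filtration_free D_ge0 DS v0_above G0 G_reg G_ord).
Qed.
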